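(* Every bounded Bessel sequence in a Hilbert space can be written as a finite union of non-spanning sets. That is, if $\{f_i\}_{i\in I}$ is a bounded Bessel sequence in a Hilbert space $\mathbb{H}$, then there are a natural number $n$ and subsets $S_1,\dots,S_n$ of $I$ with $I=\bigcup_{j=1}^n S_j$ such that, for each $j=1,\dots,n$, the family $\{f_i\}_{i\in S_j}$ does not span $\mathbb{H}$.
   Context: A family $\{f_i\}_{i\in I}$ in a (finite or infinite dimensional) Hilbert space $\mathbb{H}$ is a Bessel sequence if there is $B<\infty$ with $\sum_{i\in I}|\langle f,f_i\rangle|^2\le B\|f\|^2$ for all $f\in\mathbb{H}$. It is bounded if $0<\inf_{i\in I}\|f_i\|\le\sup_{i\in I}\|f_i\|<\infty$. A family spans $\mathbb{H}$ if its closed linear span is $\mathbb{H}$. The question whether this statement holds is known as the Sundberg Problem.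
   Formalization: The Hilbert space is assumed not to be one-dimensional, since in dimension one every nonempty bounded Bessel sequence is a counterexample (any nonzero vector spans the line). *)

(* Defs.v *)
From mathcomp Require Import all_boot all_order all_algebra sesquilinear.
From mathcomp Require Import complex.
From mathcomp Require Import all_classical all_reals all_analysis.

Set Implicit Arguments.
Unset Strict Implicit.
Unset Printing Implicit Defensive.

Import Order.TTheory GRing.Theory Num.Theory.
Import numFieldNormedType.Exports.

Local Open Scope classical_set_scope.
Local Open Scope ring_scope.

(* Hilbert spaces over both the real and the complex numbers are covered. *)
Variant scalar_kind := RealScalars | ComplexScalars.

Definition scalars (R : realType) (k : scalar_kind) : numFieldType :=
  match k with
  | RealScalars => R
  | ComplexScalars => R[i]%C
  end.

Definition scalar_conj (R : realType) (k : scalar_kind) :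
    scalars R k -> scalars R k :=
  match k return scalars R k -> scalars R k with
  | RealScalars => idfun
  | ComplexScalars => Num.conj
  end.

Definition scalar_re (R : realType) (k : scalar_kind) : scalars R k -> R :=
  match k return scalars R k -> R with
  | RealScalars => id
  | ComplexScalars => @complex.Re R
  end.

(* The library norm takes its values in the scalar field (as nonnegative
   elements); [rnorm] is the same norm, read as an element of R. *)
Definition rnorm (R : realType) (k : scalar_kind)
    (V : normedZmodType (scalars R k)) (x : V) : R :=
  scalar_re `|x|.

(* A Hilbert space is a complete normed module [H] over [scalars R k] with a
   positive definite hermitian form [ip] inducing its norm.  Forms are linear
   in the first argument and conjugate-linear in the second. *)
Definition induces_norm (R : realType) (k : scalar_kind)
    (H : completeNormedModType (scalars R k))
    (ip : {dot H for @scalar_conj R k}) : Prop :=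
  forall x : H, ip x x = `|x| ^+ 2.

Definition bessel (R : realType) (k : scalar_kind)
    (H : completeNormedModType (scalars R k))
    (ip : {dot H for @scalar_conj R k}) (I : choiceType) (f : I -> H) : Prop :=
  exists B : R, forall x : H,
    (\esum_(i in [set: I]) (rnorm (ip x (f i)) ^+ 2)%:E
       <= (B * rnorm x ^+ 2)%:E)%E.

(* The infimum and supremum are taken in the extended reals. *)
Definition bounded_family (R : realType) (k : scalar_kind)
    (H : completeNormedModType (scalars R k)) (I : choiceType) (f : I -> H) :
    Prop :=
  let norms := [set (rnorm (f i))%:E | i in [set: I]] in
  [/\ (0 < ereal_inf norms)%E, (ereal_inf norms <= ereal_sup norms)%E &
      (ereal_sup norms < +oo)%E].

Definition linear_span (K : numFieldType) (V : lmodType K) (A : set V) :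
    set V :=
  [set x | exists (n : nat) (c : 'I_n -> K) (v : 'I_n -> V),
     (forall i, A (v i)) /\ x = \sum_(i < n) c i *: v i].

Definition spans (K : numFieldType) (H : normedModType K) (I : Type)
    (f : I -> H) (S : set I) : Prop :=
  closure (linear_span (f @` S)) = [set: H].

Definition one_dimensional (K : numFieldType) (V : lmodType K) : Prop :=
  exists2 e : V, e != 0 & forall x : V, exists c : K, x = c *: e.

(* Main.v *)
(** The whole space is replaced by one nonzero vector x.  By the Bessel bound the
    sum of |<x, f_i>|^2 is small after the removal of finitely many indices,
    each of which forms a nonspanning class on its own.  It then suffices to
    colour the remaining indices with n colours in such a way that the distance
    from x to the span of each colour class stays away from 0; by compactness
    this may be done for finite subfamilies, with n and the distance independent
    of the subfamily.

    Let G be the Gram matrix of a finite subfamily, b_i = <f_i, x>, Q = 1 - G/B,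
    and F(z, y) = det(1 + diag(z) (Q - y b b^* )).  The average over all colourings c
    of prod_l F(- 1_{c = l}, y) is obtained from F^n by applying 1 - (1/n) d/dz_i
    for every i and evaluating at z = 0.  F is real stable, hence so are all
    intermediate polynomials, and the barrier argument of Marcus, Spielman and
    Srivastava bounds the logarithmic derivative in y of the average at y = 0 by a
    constant times the sum of |b_i|^2.  Since every summand is nonnegative and
    its logarithmic derivative is the sum over the classes of the squared norms
    of the projections of x, some colouring satisfies the same bound; this first
    moment argument takes the place of the interlacing families. *)

Require Import Defs.
From mathcomp Require Import all_boot all_order all_algebra sesquilinear.
From mathcomp Require Import zify ring lra complex.
From mathcomp Require Import all_classical all_reals all_analysis.

Set Implicit Arguments.
Unset Strict Implicit.
Unset Printing Implicit Defensive.

Import Order.TTheory GRing.Theory Num.Theory.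

Local Open Scope ring_scope.

(** * Complex polynomials and half-planes *)

(** Put P = G/B. At z = -1_S the value F(z, y) is the principal minor on S of P + y b b^* . If P_S
    is invertible, its logarithmic derivative at y = 0 is b_S^* P_S^-1 b_S, which is B times the
    squared norm of the projection of x onto the span of the class S. The Bessel bound enters as Q
    >= 0. The lower bound m for the squared norms enters as Q_ii <= g = 1 - m/B < 1, and this gap
    makes n independent of the subfamily: all z_i start at -t with t = (1 - g)/2, the loss caused by
    1 - (1/n) d/dz_i is made good by moving z_i from -t to 0, and the barrier 1/(n t) that this
    requires is available at the start once n t^2 >= 1. The variable y is one more coordinate with
    an operator 1 - (k/n) d/dy of its own, but it stays at 0; positivity after all operators have
    been applied is the bound n/k for the logarithmic derivative in y. Polynomials in many variables
    are avoided: a function of a matrix with one row per colour is averaged over shifts, and only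
    its restrictions to lines are polynomials. *)

Section ComplexPolynomials.
Variable C : numClosedFieldType.
Implicit Types (p q r g : {poly C}) (s : seq C).

Lemma normC_Im_le (z : C) : `|'Im z| <= `|z|.
Proof.
rewrite -(@ler_pXn2r _ 2) ?nnegrE ?normr_ge0 // (normC2_Re_Im z).
by rewrite real_normK ?Creal_Im // lerDr -real_normK ?Creal_Re // exprn_ge0.
Qed.

(** The field carries no topology; limits as e tends to 0 are taken through such linear estimates,
    which replace the continuity of polynomials. *)
Lemma le0_of_le_linear (d K : C) : d \is Num.real -> 0 <= K ->
  (forall e : C, 0 < e -> e <= 1 -> d <= K * e) -> d <= 0.
Proof.
move=> dr K0 H; rewrite real_leNgt // ?real0 //; apply/negP => d0.
have D0 : 0 < K + 1 + d by rewrite ltr_wpDl // addr_ge0.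
have e0 : 0 < d / (K + 1 + d) by rewrite divr_gt0.
have e1 : d / (K + 1 + d) <= 1 by rewrite ler_pdivrMr // mul1r lerDr addr_ge0.
have := H _ e0 e1; rewrite mulrA ler_pdivlMr // mulrC ler_pM2r //.
by rewrite -addrA gerDl => /(lt_le_trans (addr_gt0 ltr01 d0)); rewrite ltxx.
Qed.

Lemma horner_near0 p : exists2 K : C, 0 <= K &
  forall e : C, 0 < e -> e <= 1 -> `|p.[e] - p.[0]| <= K * e.
Proof.
elim/poly_ind: p => [|p c [K K0 HK]].
  by exists 0 => // e _ _; rewrite !horner0 subrr normr0 mul0r.
exists (K + `|p.[0]|) => [|e e0 e1]; first by rewrite addr_ge0.
rewrite !hornerE addrK normrM (gtr0_norm e0).
rewrite ler_wpM2r ?(ltW e0) // -[p.[e]](subrK p.[0]).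
apply: le_trans (ler_normD _ _) _; rewrite lerD2r.
by apply: le_trans (HK _ e0 e1) _; rewrite ler_piMr.
Qed.

Lemma Im_horner_ge0_lim p :
  (forall e : C, 0 < e -> 0 <= 'Im p.[e]) -> 0 <= 'Im p.[0].
Proof.
move=> H; have [K K0 HK] := horner_near0 p.
rewrite -oppr_le0; apply: (@le0_of_le_linear _ K) => // [|e e0 e1].
  by rewrite rpredN Creal_Im.
apply: le_trans (HK e e0 e1); apply: le_trans (normC_Im_le _).
rewrite raddfB /=; apply: le_trans (real_ler_norm _); last first.
  by rewrite rpredB ?Creal_Im.
by rewrite lerDr H.
Qed.

Lemma norm_horner_le_lim p q (M : C) : 0 <= M ->
  (forall e : C, 0 < e -> `|p.[e]| <= M * `|q.[e]|) -> `|p.[0]| <= M * `|q.[0]|.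
Proof.
move=> M0 H; have [K K0 HK] := horner_near0 p.
have [L L0 HL] := horner_near0 q.
have ger (x : C) : 0 <= x -> x \is Num.real by exact: ger0_real.
rewrite -subr_le0; apply: (@le0_of_le_linear _ (K + M * L)) => [||e e0 e1].
- by rewrite rpredB ?ger ?mulr_ge0.
- by rewrite addr_ge0 ?mulr_ge0.
rewrite lerBlDr mulrDl -addrA -mulrA -mulrDr.
apply: le_trans (_ : K * e + `|p.[e]| <= _).
  rewrite -lerBlDr; apply: le_trans (HK e e0 e1).
  by rewrite distrC; apply: le_trans (lerB_dist _ _).
rewrite lerD2l; apply: le_trans (H e e0) _; rewrite ler_wpM2l //.
rewrite -lerBlDr; apply: le_trans (HL e e0 e1).
exact: lerB_dist.
Qed.

Lemma horner_deriv_prod s (x : C) : x \notin s ->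
  (\prod_(z <- s) ('X - z%:P))^`().[x] =
  (\prod_(z <- s) ('X - z%:P)).[x] * \sum_(z <- s) (x - z)^-1.
Proof.
elim: s => [|z s IH] /=; first by rewrite !big_nil derivC horner0 mulr0.
rewrite inE negb_or => /andP[xz xs].
rewrite !big_cons derivM !hornerE derivXsubC !hornerE IH // mulrDr mulrAC.
by rewrite divff ?subr_eq0 // mul1r mulrA.
Qed.

Lemma horner_prodXsubC s (x : C) :
  (\prod_(z <- s) ('X - z%:P)).[x] = \prod_(z <- s) (x - z).
Proof. by rewrite horner_prod; apply: eq_bigr => z _; rewrite !hornerE. Qed.

Lemma roots_lower p s : (forall u : C, 0 <= 'Im u -> p.[u] != 0) ->
  p = lead_coef p *: \prod_(z <- s) ('X - z%:P) ->
  forall z, z \in s -> 'Im z < 0.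
Proof.
move=> H ps z zs; rewrite real_ltNge ?Creal_Im ?real0 //.
apply: contraL (zs) => zi; apply: contraNN (H z zi) => zs'.
rewrite ps hornerZ horner_prodXsubC (big_rem z) //=.
by rewrite subrr mul0r mulr0.
Qed.

(* By hypothesis the roots of p lie in the open lower half-plane, so that of
   each summand 1/(-z) of p'(0)/p(0). *)
Lemma Im_logderiv_lt0 p : (forall u : C, 0 <= 'Im u -> p.[u] != 0) ->
  p^`() = 0 \/ 'Im (p^`().[0] * (p.[0])^* ) < 0.
Proof.
move=> H; have [s ps] := closed_field_poly_normal p.
have p0 : p.[0] != 0 by apply: H; rewrite raddf0.
have lp0 : lead_coef p != 0.
  by rewrite lead_coef_eq0; apply: contraNneq p0 => ->; rewrite horner0.
have sneg := roots_lower H ps.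
case: s => [|z0 s] in ps sneg *.
  by left; rewrite ps big_nil -mul_polyC mulr1 derivC.
right.
have s0 : 0 \notin z0 :: s.
  by apply/negP => /sneg; rewrite raddf0 ltxx.
have -> : p^`().[0] = p.[0] * \sum_(z <- z0 :: s) (0 - z)^-1.
  by rewrite ps derivZ !hornerZ -mulrA horner_deriv_prod.
rewrite mulrAC -normCK ImMl ?realX ?normr_real //.
rewrite pmulr_rlt0 ?exprn_gt0 ?normr_gt0 // raddf_sum /=.
have term z : z \in z0 :: s -> 'Im (0 - z)^-1 < 0.
  move=> zs; rewrite sub0r ImV raddfN /= opprK.
  by rewrite pmulr_llt0 ?sneg // invr_gt0 exprn_gt0 // normrN normr_gt0;
    apply: contraNneq s0 => <-.
rewrite big_cons; apply: ltr_wnDr; last by apply: term; rewrite mem_head.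
rewrite big_seq; apply: sumr_le0 => z zs; apply/ltW/term.
by rewrite inE zs orbT.
Qed.

(** Every root z lies below the real axis, so |z| <= |u - z| + |u| and |u - z| >= Im u. The factor
    depends on n and u only; this uniformity replaces Hurwitz's theorem in [stable_upper_neq0]. *)
Lemma horner0_le_upper p n (u : C) :
  (size p <= n.+1)%N -> (forall v : C, 0 <= 'Im v -> p.[v] != 0) ->
  0 < 'Im u -> `|p.[0]| <= (1 + `|u| / 'Im u) ^+ n * `|p.[u]|.
Proof.
move=> sp H u0; have [s ps] := closed_field_poly_normal p.
have p0 : p.[0] != 0 by apply: H; rewrite raddf0.
have lp0 : lead_coef p != 0.
  by rewrite lead_coef_eq0; apply: contraNneq p0 => ->; rewrite horner0.
have sn : (size s <= n)%N.
  by move: sp; rewrite ps size_scale // size_prod_XsubC.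
have sneg := roots_lower H ps.
have M1 : 1 <= 1 + `|u| / 'Im u by rewrite lerDl divr_ge0 // ltW.
have M0 := le_trans ler01 M1.
apply: le_trans (_ : (1 + `|u| / 'Im u) ^+ size s * `|p.[u]| <= _); last first.
  by apply: ler_wpM2r => //; apply: ler_weXn2l.
rewrite ps !hornerZ !normrM mulrCA ler_wpM2l // !horner_prodXsubC !normr_prod.
have {}sneg : all (fun z => 'Im z < 0) s by apply/allP.
elim: s sneg {ps sn} => [|z s IH] /=; first by rewrite !big_nil expr0 mulr1.
move=> /andP[zi /IH{}IH]; rewrite !big_cons exprS mulrACA.
apply: ler_pM => //; first by rewrite prodr_ge0.
rewrite mulrDl mul1r; apply: le_trans (_ : `|u - z| + `|u| <= _).
  have -> : 0 - z = u - z - u by ring.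
  exact: ler_normB.
rewrite lerD2l mulrAC ler_pdivlMr // ler_wpM2l //.
apply: le_trans (normC_Im_le _); rewrite raddfB /= ger0_norm; last first.
  by rewrite subr_ge0 (le_trans (ltW zi)) // ltW.
by rewrite lerDl oppr_ge0 ltW.
Qed.

(** * Real polynomials and rational self-maps of the upper half-plane *)

Definition real_poly p := map_poly Num.conj p = p.

Lemma real_poly_horner p (x : C) : real_poly p -> x \is Num.real ->
  p.[x] \is Num.real.
Proof.
move=> pr /CrealP xr; apply/CrealP.
by rewrite -[RHS](congr1 (fun q => q.[x]) pr) -{2}xr horner_map.
Qed.

Lemma real_poly_XsubC (x : C) : x \is Num.real -> real_poly ('X - x%:P).
Proof.
by move=> /CrealP xr; rewrite /real_poly rmorphB /= map_polyX map_polyC /= xr.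
Qed.

Lemma real_polyD p q : real_poly p -> real_poly q -> real_poly (p + q).
Proof. by rewrite /real_poly rmorphD /= => -> ->. Qed.

Lemma real_polyZ (a : C) p : a \is Num.real -> real_poly p -> real_poly (a *: p).
Proof. by move=> /CrealP ar; rewrite /real_poly map_polyZ /= ar => ->. Qed.

Lemma real_poly_sum (J : eqType) (t : seq J) (f : J -> {poly C}) :
  {in t, forall j, real_poly (f j)} -> real_poly (\sum_(j <- t) f j).
Proof.
move=> H; rewrite big_seq; elim/big_ind: _ => //; last exact: real_polyD.
by rewrite /real_poly rmorph0.
Qed.

Lemma real_poly_divl p q : q != 0 -> real_poly q -> real_poly (q * p) ->
  real_poly p.
Proof. by rewrite /real_poly rmorphM /= => q0 -> /(mulfI q0). Qed.

Lemma real_poly_lead p : real_poly p -> lead_coef p \is Num.real.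
Proof.
by move=> pr; apply/CrealP; rewrite lead_coefE -coef_map pr.
Qed.

Lemma conj_horner_real p (x : C) : x \is Num.real ->
  (p.[x])^* = (map_poly Num.conj p).[x].
Proof. by move=> /CrealP xr; rewrite -{2}xr horner_map. Qed.

(* The n-th roots of t sum to 0 and are not real, so one of them has positive
   imaginary part. *)
Lemma root_in_upper n (t : C) : (1 < n)%N -> t \isn't Num.real ->
  exists2 w : C, 0 < 'Im w & w ^+ n = t.
Proof.
move=> n1 tr; have [s ps] := closed_field_poly_normal ('X^n - t%:P).
have n0 : (0 < n)%N by apply: ltnW.
have lc : lead_coef ('X^n - t%:P) = 1 by apply/eqP/monicXnsubC.
rewrite lc scale1r in ps.
have ss : size s = n.
  by apply/eqP; rewrite -eqSS -(size_prod_XsubC s id) -ps size_XnsubC.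
have rs w : w \in s -> w ^+ n = t.
  move=> ws; have : ('X^n - t%:P).[w] = 0.
    by rewrite ps horner_prodXsubC (big_rem w) //= subrr mul0r.
  by rewrite !hornerE => /eqP; rewrite subr_eq0 => /eqP.
case: (hasP (a := fun w => 0 < 'Im w) (s := s)) => [[w /rs wn w0]|H].
  by exists w.
have Hn w : w \in s -> 'Im w <= 0.
  move=> ws; rewrite real_leNgt ?Creal_Im ?real0 //.
  by apply/negP => w0; apply: H; exists w.
have sum0 : \sum_(w <- s) w = 0.
  have := @coefPn_prod_XsubC _ s; rewrite ss -ps -lt0n => /(_ n0) /eqP.
  rewrite !coefE -subn1 (_ : ((n - 1)%N == n) = false); last by lia.
  rewrite (_ : ((n - 1)%N == 0%N) = false); last by lia.
  by rewrite subr0 eq_sym oppr_eq0 => /eqP.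
have : \sum_(w <- s) - 'Im w == 0 by rewrite sumrN -raddf_sum /= sum0 raddf0 oppr0.
rewrite big_seq psumr_eq0 => [/allP Hs|w /Hn]; last by rewrite oppr_ge0.
case: s => [|w s] in ps ss rs H Hn sum0 Hs *; first by rewrite -ss in n0.
have := Hs w (mem_head _ _); rewrite mem_head /= oppr_eq0 => /eqP/Creal_ImP wr.
by case/negP: tr; rewrite -(rs w) ?mem_head // rpredX.
Qed.

(** For n > 1 both i and -i have n-th roots in the upper half-plane, which forces both signs on
    a. *)
Lemma Im_upper_powers n (a : C) : a \is Num.real ->
  (forall w : C, 0 < 'Im w -> 0 <= 'Im (a * w ^+ n)) ->
  (n = 1%N -> 0 <= a) /\ ((1 < n)%N -> a = 0).
Proof.
move=> ar H; split=> [n1|n1].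
  by have := H 'i; rewrite Im_i ltr01 n1 expr1 ImMl // Im_i mulr1; apply.
have inr : 'i \isn't (@Num.real C) by apply/negP => /Creal_ImP/eqP; rewrite Im_i oner_eq0.
have inr' : - 'i \isn't (@Num.real C) by rewrite rpredN.
have [w w0 wn] := root_in_upper n1 inr.
have [v v0 vn] := root_in_upper n1 inr'.
have := H w w0; have := H v v0.
rewrite wn vn !ImMl // raddfN /= Im_i mulr1 mulrN1 oppr_ge0 => a0 a1.
by apply/le_anti; rewrite a0 a1.
Qed.

(** Put u = z + e w in the hypothesis and divide by e^n; as e tends to 0 there remains Im (r(z) p(z)
    conj(w)^n) >= 0 for every w in the upper half-plane. *)
Lemma residue_sign r p n (z : C) : z \is Num.real ->
  r.[z] \is Num.real -> p.[z] \is Num.real -> p.[z] != 0 ->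
  (forall u : C, 0 < 'Im u ->
     0 <= 'Im (r.[u] * ((('X - z%:P) ^+ n * p).[u])^* )) ->
  (n = 1%N -> r.[z] / p.[z] <= 0) /\ ((1 < n)%N -> r.[z] = 0).
Proof.
move=> zr rr pr p0 H.
have pp : 0 < p.[z] ^+ 2.
  by rewrite -real_normK // exprn_gt0 // normr_gt0.
have Hw w : 0 < 'Im w -> 0 <= 'Im (- (r.[z] * p.[z]) * w ^+ n).
  move=> w0; pose l := z%:P + w *: 'X : {poly C}.
  pose h := (w^* ^+ n)%:P * (r \Po l) * map_poly Num.conj (p \Po l).
  have le e : l.[e] = z + w * e by rewrite !hornerE.
  have : 0 <= 'Im h.[0].
    apply: Im_horner_ge0_lim => e e0.
    have er : e \is Num.real by rewrite realE ltW.
    have := H (z + w * e); rewrite raddfD /= (Creal_ImP _ zr) add0r ImMr //.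
    rewrite mulr_gt0 // => /(_ isT).
    rewrite /h !hornerM hornerC -conj_horner_real // !horner_comp le.
    rewrite horner_exp !hornerE.
    rewrite [z + _ - z]addrAC subrr add0r exprMn !rmorphM !rmorphXn /=.
    rewrite (CrealP er); set W := w^* ^+ n; set U := r.[_]; set V := (p.[_])^*.
    have -> : U * (W * e ^+ n * V) = e ^+ n * (W * U * V) by ring.
    by rewrite ImMl ?rpredX // pmulr_rge0 ?exprn_gt0.
  rewrite /h !hornerM hornerC -conj_horner_real ?real0 // !horner_comp le mulr0 addr0.
  rewrite (CrealP pr) -mulrA ImMr ?rpredM // -rmorphXn Im_conj /=.
  by rewrite ImMl ?rpredN ?rpredM // !mulNr mulrC.
have arr : - (r.[z] * p.[z]) \is Num.real by rewrite rpredN rpredM.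
have [H1 H2] := Im_upper_powers arr Hw; split=> [/H1|/H2/eqP].
  rewrite oppr_ge0 => rp; rewrite -(pmulr_lle0 _ pp) expr2.
  by rewrite mulrA divfK.
by rewrite oppr_eq0 mulf_eq0 (negPf p0) orbF => /eqP.
Qed.
(** Put u = w/e and multiply by e^m, where m is the degree: as e tends to 0 the error term
    disappears and Im (lead_coef q * w^m) >= 0 remains, which excludes m > 1. *)
Lemma affine_of_Im_bound q (K : C) : real_poly q -> 0 <= K ->
  (forall u : C, 0 < 'Im u -> - (K / 'Im u) <= 'Im q.[u]) ->
  exists a b : C, [/\ 0 <= a, b \is Num.real & q = b%:P + a *: 'X].
Proof.
move=> qr K0 H; have [->|q0] := eqVneq q 0.
  by exists 0, 0; split; rewrite ?real0 // scale0r addr0.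
set m := (size q).-1.
have sq : size q = m.+1 by rewrite prednK // size_poly_gt0.
have Hw w : 0 < 'Im w -> 0 <= 'Im (lead_coef q * w ^+ m).
  move=> w0.
  pose h : {poly C} := \sum_(i < m.+1) (q`_i * w ^+ i) *: 'X^(m - i)
                        + ('i * (K / 'Im w)) *: 'X^(m.+1).
  have -> : lead_coef q * w ^+ m = h.[0].
    rewrite /h hornerD hornerZ hornerXn expr0n mulr0 addr0 horner_sum.
    rewrite big_ord_recr /= big1 => [|i _]; last first.
      by rewrite hornerZ hornerXn expr0n subn_eq0 leqNgt ltn_ord mulr0.
    by rewrite add0r hornerZ hornerXn subnn expr0 mulr1 lead_coefE.
  apply: Im_horner_ge0_lim => e e0.
  have er : e \is Num.real by rewrite realE ltW.
  have en : e != 0 by rewrite gt_eqF.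
  have hE : h.[e] = e ^+ m * (q.[w / e] + 'i * (K * e / 'Im w)).
    rewrite /h hornerD hornerZ hornerXn horner_sum mulrDr; congr (_ + _); last first.
      by rewrite exprS; ring.
    rewrite horner_coef sq mulr_sumr; apply: eq_bigr => i _.
    rewrite hornerZ hornerXn expr_div_n.
    have -> : e ^+ m = e ^+ (m - i) * e ^+ i by rewrite -exprD subnK // -ltnS.
    by field; rewrite expf_neq0.
  have := H (w / e); rewrite ImMr ?rpredV // divr_gt0 // => /(_ isT) He.
  rewrite hE ImMl ?rpredX // mulr_ge0 ?exprn_ge0 ?(ltW e0) //.
  rewrite raddfD /= ImMil (Creal_ReP _ _); last first.
    by rewrite realE divr_ge0 ?mulr_ge0 // ltW.
  rewrite -lerBlDr sub0r; congr (_ <= _): He; congr (- _).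
  by field; rewrite en gt_eqF.
have [H1 H2] := Im_upper_powers (real_poly_lead qr) Hw.
have [m1|m1] := ltnP 1 m.
  by case/eqP: q0; apply/eqP; rewrite -lead_coef_eq0 H2.
have qE : q = (q`_0)%:P + q`_1 *: 'X.
  apply/polyP => i; rewrite !coefE.
  case: i => [|[|i]] /=; rewrite ?mulr0 ?mulr1 ?addr0 ?add0r //.
  by rewrite nth_default // sq; lia.
have q0r : q`_0 \is Num.real.
  by apply/CrealP; rewrite -coef_map qr.
exists q`_1, q`_0; split=> //.
move: m1; rewrite leq_eqVlt ltnS leqn0 => /orP[] /eqP m1.
  by rewrite m1 in sq; rewrite -[1%N]/(2.-1) -sq -lead_coefE H1.
by rewrite nth_default // sq m1.
Qed.

(* That is, q / (X p) = a + sum_z w_z / (X - z) with a, w_z >= 0 and z < 0. *)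
Definition cone_over p q := exists (a : C) (L : seq (C * {poly C})),
  [/\ 0 <= a,
      forall x, x \in L -> 0 <= x.1 /\ exists2 z, z < 0 & p = ('X - z%:P) * x.2 &
      q = 'X * (a *: p + \sum_(x <- L) x.1 *: x.2)].

Lemma cone_overM p q g : cone_over p q -> cone_over (g * p) (g * q).
Proof.
move=> [a [L [a0 HL ->]]]; exists a, [seq (x.1, g * x.2) | x <- L]; split=> //.
  move=> _ /mapP[x xL ->] /=; have [x0 [z z0 ->]] := HL x xL.
  by split=> //; exists z => //; rewrite mulrCA.
rewrite mulrCA; congr (_ * _); rewrite mulrDr -scalerAr; congr (_ + _).
rewrite big_map mulr_sumr; apply: eq_bigr => x _.
by rewrite -scalerAr.
Qed.

Lemma prod_XsubC_split s (z : C) :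
  \prod_(x <- s) ('X - x%:P) =
  ('X - z%:P) ^+ (count_mem z s) * \prod_(x <- s | x != z) ('X - x%:P).
Proof.
elim: s => [|x s IH] /=; first by rewrite !big_nil expr0 mulr1.
rewrite !big_cons IH; case: eqVneq => [->|_] /=; first by rewrite exprS mulrA.
by rewrite mulrCA.
Qed.

(** The quotient r/p maps the upper half-plane into its closure. The induction cancels common roots;
    after that a multiple root of p would again be a root of r, so all poles are simple and r/p = b
    + a X - sum_z c_z / (X - z) with c_z >= 0. Subtracting the value at 0 turns - c_z / (X - z) into
    X (- c_z / z) / (X - z), where - c_z / z >= 0 because z < 0. *)
Lemma partial_fraction_cone s r : all (fun z => z < 0) s -> real_poly r ->
  (forall u : C, 0 < 'Im u ->
     0 <= 'Im (r.[u] * ((\prod_(z <- s) ('X - z%:P)).[u])^* )) ->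
  let p := \prod_(z <- s) ('X - z%:P) in
  cone_over p (r - (r.[0] / p.[0]) *: p).
Proof.
have [m] := ubnP (size s); elim: m s r => // m IH s r sm s0 rr H p.
have sreal z : z \in s -> z \is Num.real.
  by move=> /(allP s0) z0; rewrite realE (ltW z0) orbT.
have [/hasP[z zs rz]|] := boolP (has (root r) s).
  have /factor_theorem[r1 r1E] := rz.
  have pE : p = ('X - z%:P) * \prod_(x <- rem z s) ('X - x%:P).
    by rewrite /p (perm_big _ (perm_to_rem zs)) big_cons.
  have z0 := allP s0 z zs.
  have zr := sreal z zs.
  have -> : r - (r.[0] / p.[0]) *: p = ('X - z%:P) * (r1 -
     (r1.[0] / (\prod_(x <- rem z s) ('X - x%:P)).[0]) *:
     \prod_(x <- rem z s) ('X - x%:P)).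
    rewrite mulrBr -scalerAr -pE [_ * r1]mulrC -r1E; congr (_ - _ *: _).
    rewrite r1E pE !hornerM [r1.[0] * ('X - _).[0]]mulrC -mulf_div divff ?mul1r //.
    by rewrite !hornerE oppr_eq0 lt_eqF.
  rewrite pE; apply/cone_overM/IH.
  - by rewrite size_rem //; case: (s) zs sm.
  - by apply/allP => x /mem_rem/(allP s0).
  - apply: real_poly_divl (negbT (polyXsubC_eq0 z)) (real_poly_XsubC zr) _.
    by rewrite mulrC -r1E.
  move=> u u0; have := H u u0; rewrite -/p pE r1E !hornerM rmorphM /=.
  set P := ('X - _).[u]; set Q := (\prod_(_ <- _) _).[u]; set R := r1.[u].
  have -> : R * P * (P^* * Q^* ) = `|P| ^+ 2 * (R * Q^* ) by rewrite normCK; ring.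
  rewrite ImMl ?rpredX ?normr_real // pmulr_rge0 // exprn_gt0 // normr_gt0.
  rewrite /P !hornerE subr_eq0; apply: contraTneq u0 => ->.
  by rewrite (Creal_ImP _ zr) ltxx.
move=> /hasPn nr.
pose f z := \prod_(x <- s | x != z) ('X - x%:P).
have fr z : real_poly (f z).
  rewrite /real_poly /f map_prod_XsubC big_seq_cond [RHS]big_seq_cond.
  by apply: eq_bigr => x /andP[/sreal/CrealP xr _] /=; rewrite xr.
have fz0 z : (f z).[z] != 0.
  rewrite /f horner_prod prodf_seq_neq0; apply/allP => x _; apply/implyP.
  by rewrite !hornerE subr_eq0 eq_sym.
have fx0 z x : z \in s -> z != x -> (f x).[z] = 0.
  move=> zs zx; rewrite /f horner_prod (big_rem z) //= zx.
  by rewrite !hornerE subrr mul0r.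
have pr : real_poly p.
  rewrite /real_poly /p map_prod_XsubC big_seq [RHS]big_seq.
  by apply: eq_bigr => x /sreal/CrealP xr /=; rewrite xr.
have count1 z : z \in s -> count_mem z s = 1%N /\ r.[z] / (f z).[z] <= 0.
  move=> zs; have zr := sreal z zs.
  have := @residue_sign r (f z) (count_mem z s) z zr.
  rewrite -prod_XsubC_split => /(_ _ _ (fz0 z) H).
  rewrite !real_poly_horner // => -[] // H1 H2.
  have : (0 < count_mem z s)%N by rewrite -has_count has_pred1.
  rewrite leq_eqVlt => /orP[/eqP c1|/H2 /eqP r0]; first by split=> //; apply: H1.
  by have := nr z zs; rewrite /root r0.
have us : uniq s.
  apply: count_mem_uniq => z; case: (boolP (z \in s)) => [/count1[-> //]|zs].
  by rewrite (count_memPn zs).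
have pE z : z \in s -> p = ('X - z%:P) * f z.
  by move=> zs; rewrite /p (prod_XsubC_split _ z); have [-> _] := count1 z zs.
have pn0 : p != 0 by apply/monic_neq0/monic_prod_XsubC.
pose c z := - (r.[z] / (f z).[z]).
have c0 z : z \in s -> 0 <= c z by move=> /count1[_]; rewrite /c oppr_ge0.
pose T := r + \sum_(z <- s) c z *: f z.
have /dvdpP[S TE] : p %| T.
  apply: uniq_roots_dvdp; last by rewrite uniq_rootsE.
  apply/allP => z zs; rewrite /root /T hornerD horner_sum (big_rem z) //=.
  rewrite big_seq big1 => [|x]; last first.
    rewrite mem_rem_uniq // => /andP[/= xz xs].
    by rewrite hornerZ fx0 ?mulr0 // eq_sym.
  by rewrite addr0 hornerZ /c mulNr divfK ?subrr.
have Sr : real_poly S.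
  apply: (real_poly_divl pn0 pr); rewrite mulrC -TE; apply: real_polyD => //.
  apply: real_poly_sum => z zs; apply: real_polyZ => //.
  by rewrite realE c0.
have K0 : 0 <= \sum_(z <- s) c z by rewrite big_seq sumr_ge0.
have pu u : 0 < 'Im u -> p.[u] != 0.
  move=> u0; rewrite /p -[_ != 0]/(~~ root _ u) root_prod_XsubC.
  by apply: contraTN u0 => /sreal/Creal_ImP ->; rewrite ltxx.
(* S is r/p with its poles removed, and Im (c_z / (u - z)) >= - c_z / Im u. *)
have [u u0|a [b [a0 br SE]]] := affine_of_Im_bound Sr K0.
  have SuE : S.[u] = r.[u] / p.[u] + \sum_(z <- s) c z / (u - z).
    apply: (mulIf (pu u u0)); rewrite -hornerM -TE /T hornerD horner_sum.
    rewrite mulrDl divfK ?pu // mulr_suml big_seq [in RHS]big_seq; congr (_ + _).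
    apply: eq_bigr => z zs; rewrite hornerZ (pE z zs) hornerM mulrA !hornerE.
    rewrite divfK // subr_eq0; apply: contraTneq u0 => ->.
    by rewrite (Creal_ImP _ (sreal z zs)) ltxx.
  rewrite SuE raddfD /= raddf_sum /= -[leLHS]add0r; apply: lerD.
    rewrite -(pmulr_rge0 _ (_ : 0 < `|p.[u]| ^+ 2)) ?exprn_gt0 ?normr_gt0 ?pu //.
    rewrite -ImMl ?rpredX ?normr_real // normCK -mulrA [_^* * _]mulrC.
    by rewrite mulrA [_ * (_ / _)]mulrC divfK ?pu //; exact: H.
  rewrite mulr_suml -sumrN big_seq [leRHS]big_seq; apply: ler_sum => z zs.
  have zr := sreal z zs.
  have uz : 'Im (u - z) = 'Im u by rewrite raddfB /= (Creal_ImP _ zr) subr0.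
  rewrite ImMl ?realE ?c0 // ImV uz -mulrN ler_wpM2l ?c0 // mulNr lerN2.
  have n0 : 0 < `|u - z| ^+ 2.
    rewrite exprn_gt0 // normr_gt0; apply: contraTneq u0 => uz0.
    by rewrite -uz uz0 raddf0 ltxx.
  rewrite ler_pdivrMr // mulrC ler_pdivlMr // -expr2 ler_pXn2r ?nnegrE ?normr_ge0 ?(ltW u0) //.
  by apply: le_trans (normC_Im_le (u - z)); rewrite uz ger0_norm // ltW.
exists a, [seq (- (c z / z), f z) | z <- s]; split=> //.
  move=> _ /mapP[z zs ->] /=; have z0 := allP s0 z zs; split.
    by rewrite -mulrN -invrN mulr_ge0 ?c0 // invr_ge0 oppr_ge0 ltW.
  by exists z => //; apply: pE.
have rE : r = S * p - \sum_(z <- s) c z *: f z by rewrite -TE /T addrK.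
have p00 : p.[0] != 0.
  rewrite -[_ != 0]/(~~ root _ _) root_prod_XsubC.
  by apply/negP => /(allP s0); rewrite ltxx.
have h0 : r.[0] / p.[0] = b + \sum_(z <- s) c z / z.
  rewrite rE hornerD hornerM hornerN mulrDl mulfK // SE !hornerE mulNr.
  congr (_ + _); rewrite horner_sum mulr_suml -sumrN big_seq [RHS]big_seq.
  apply: eq_bigr => z zs; have z0 := allP s0 z zs.
  rewrite hornerZ (pE z zs) hornerM !hornerE.
  have fn0 : (f z).[0] != 0.
    by move: p00; rewrite (pE z zs) hornerM mulf_eq0 negb_or => /andP[].
  by field; rewrite fn0 lt_eqF.
rewrite h0 {1}rE {1}SE mulrDr big_map /= mulr_sumr scalerDl scaler_suml.
have -> : \sum_(z <- s) (c z / z) *: p =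
    \sum_(z <- s) 'X * ((c z / z) *: f z) - \sum_(z <- s) c z *: f z.
  rewrite -sumrB big_seq [RHS]big_seq; apply: eq_bigr => z zs.
  rewrite (pE z zs) mulrBl scalerBr -scalerAr; congr (_ - _).
  by rewrite mul_polyC scalerA divfK // lt_eqF // (allP s0).
have -> : \sum_(z <- s) 'X * (- (c z / z) *: f z) =
    - \sum_(z <- s) 'X * ((c z / z) *: f z).
  by rewrite -sumrN; apply: eq_bigr => z _; rewrite scaleNr mulrN.
by rewrite mulrDl mul_polyC -scalerAl -scalerAr; ring.
Qed.
Lemma cone_over_ge0 p q (t : C) : cone_over p q -> 0 <= t -> 0 < p.[t] ->
  0 <= q.[t].
Proof.
move=> [a [L [a0 HL ->]]] t0 pt; rewrite hornerM hornerX hornerD hornerZ.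
apply: mulr_ge0 => //; apply: addr_ge0; first by rewrite mulr_ge0 // ltW.
rewrite horner_sum big_seq sumr_ge0 // => x /HL[x0 [z z0 pE]]; rewrite hornerZ mulr_ge0 // ltW //.
have zt : 0 < t - z by rewrite subr_gt0 (lt_le_trans z0).
by move: pt; rewrite pE hornerM !hornerE pmulr_rgt0.
Qed.

(** The quotient h = q/p is nonnegative and concave on the half-line with h(0) = 0, so t h'(t) <=
    h(t). Hence q - c q' = h (p - c p') - c h' p >= c p (h/t - h') >= 0. The proof checks this for
    each summand of the cone. *)
Lemma cone_over_barrier p q (t c : C) : cone_over p q -> 0 < t -> 0 <= c ->
  0 < p.[t] -> c / t * p.[t] <= p.[t] - c * p^`().[t] ->
  0 <= q.[t] - c * q^`().[t].
Proof.
move=> [a [L [a0 HL ->]]] t0 c0 pt bar.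
pose F g := t * g.[t] - c * g.[t] - t * c * g^`().[t].
have FD g1 g2 : F (g1 + g2) = F g1 + F g2.
  by rewrite /F derivD !hornerD; ring.
have FZ x g : F (x *: g) = x * F g by rewrite /F derivZ !hornerZ; ring.
have Fp : 0 <= F p.
  rewrite /F -addrA -opprD subr_ge0 addrC.
  have -> : t * c * p^`().[t] + c * p.[t] = t * (c * p^`().[t] + c / t * p.[t]).
    by field; rewrite gt_eqF.
  by rewrite ler_pM2l // addrC -lerBrDr.
have Fg g z : z < 0 -> p = ('X - z%:P) * g -> 0 <= F g.
  move=> z0 pE; have zt : 0 < t - z by rewrite subr_gt0 (lt_trans z0).
  have gt0 : 0 < g.[t] by move: pt; rewrite pE hornerM !hornerE pmulr_rgt0.
  rewrite -(pmulr_rge0 _ zt).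
  have -> : (t - z) * F g = F p + t * c * g.[t].
    by rewrite /F pE derivM derivXsubC mul1r !(hornerM, hornerXsubC, hornerD); ring.
  by rewrite addr_ge0 // mulr_ge0 ?mulr_ge0 // ltW.
have FX g : ('X * g).[t] - c * ('X * g)^`().[t] = F g.
  by rewrite /F derivM derivX mul1r !(hornerD, hornerM, hornerX); ring.
rewrite FX FD FZ addr_ge0 ?mulr_ge0 //.
elim: L HL => [_|x L IH HL].
  by rewrite big_nil /F derivC !horner0 !mulr0 !subr0.
rewrite big_cons FD FZ addr_ge0 //; last first.
  by apply: IH => y yL; apply: HL; rewrite inE yL orbT.
have [x0 [z z0 pE]] := HL x (mem_head _ _).
by rewrite mulr_ge0 // (Fg _ z).
Qed.

Lemma real_rooted_barrier p r : real_poly r ->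
  (forall u : C, p.[u] = 0 -> u < 0) -> 0 < p.[0] ->
  (forall u : C, 0 < 'Im u -> 0 <= 'Im (r.[u] * (p.[u])^* )) ->
  let q := r - (r.[0] / p.[0]) *: p in
  (forall t : C, 0 <= t -> 0 < p.[t] /\ 0 <= q.[t]) /\
  (forall t c : C, 0 < t -> 0 <= c ->
     c / t * p.[t] <= p.[t] - c * p^`().[t] -> 0 <= q.[t] - c * q^`().[t]).
Proof.
move=> rr proots p0 H q; have [s pE] := closed_field_poly_normal p.
set P := \prod_(z <- s) _ in pE; set l := lead_coef p in pE.
have ln0 : l != 0.
  by apply: contraTneq p0 => l0; rewrite pE l0 scale0r horner0 ltxx.
have sneg : all (fun z => z < 0) s.
  apply/allP => z zs; apply: proots; rewrite pE hornerZ.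
  by rewrite /P horner_prodXsubC (big_rem z) //= subrr mul0r mulr0.
have Pt t : 0 <= t -> 0 < P.[t].
  move=> t0; rewrite /P horner_prodXsubC big_seq prodr_gt0 // => z zs.
  by rewrite subr_gt0 (lt_le_trans _ t0) // (allP sneg).
have l0 : 0 < l by move: p0; rewrite pE hornerZ pmulr_lgt0 // Pt.
have qE : q = r - (r.[0] / P.[0]) *: P.
  rewrite /q pE hornerZ scalerA; congr (_ - _ *: _).
  by field; rewrite ln0 gt_eqF ?Pt.
have cq : cone_over P q.
  rewrite qE; apply: partial_fraction_cone => // u u0.
  have := H u u0; rewrite pE hornerZ rmorphM /= (CrealP _) ?gtr0_real //.
  by rewrite mulrCA ImMl ?gtr0_real // pmulr_rge0.
split=> [t t0|t c t0 c0 bar].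
  split; first by rewrite pE hornerZ mulr_gt0 // Pt.
  exact: (cone_over_ge0 cq t0 (Pt _ t0)).
apply: cone_over_barrier cq t0 c0 (Pt _ (ltW t0)) _.
move: bar; rewrite pE derivZ !hornerZ mulrCA [c * (l * _)]mulrCA -mulrBr.
by rewrite ler_pM2l.
Qed.
End ComplexPolynomials.

(** * Stable functionals and their barriers *)

Lemma poly_ext (R : numDomainType) (p q : {poly R}) :
  (forall x, p.[x] = q.[x]) -> p = q.
Proof.
move=> H; apply/eqP; rewrite -subr_eq0; apply/negPn/negP => pq0.
pose rs := [seq k%:R : R | k <- iota 0 (size (p - q))].
have := max_poly_roots pq0 (_ : all (root (p - q)) rs).
rewrite size_map size_iota ltnn => Hr; apply/notF/Hr.
  by apply/allP => x _; rewrite /root hornerD hornerN H subrr.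
by rewrite map_inj_uniq ?iota_uniq //; apply/mulrIn/oner_neq0.
Qed.

Section StableFunctionals.
Variables (C : numClosedFieldType) (n' N : nat) (kappa : 'I_N -> C).
Local Notation n := n'.+1.
Hypothesis kappa_gt0 : forall i, 0 < kappa i.
Implicit Types (G : 'M[C]_(n, N) -> C) (s : 'M[C]_(n, N)).

(* Row l of a point s holds the variables of the l-th colour.  On products over l
   of functions of row l that are affine in each variable, color_shift G i is
   G - (kappa i / n) dG, where d differentiates in direction dirmx i. *)
Definition color_shift G (i : 'I_N) s : C :=
  n%:R^-1 * \sum_(l < n) G (s - kappa i *: delta_mx l i).

Definition dirmx (i : 'I_N) : 'M[C]_(n, N) := \matrix_(l, j) (j == i)%:R.

(** These are the properties of a real stable polynomial that the barrier argument consumes: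
    polynomial restrictions to lines, degree at most n in each [dirmx] direction, where
    [color_shift] is a differential operator, real coefficients, and no zero with all coordinates in
    the upper half-plane. *)
Record stable_functional G : Prop := StableFunctional {
  stable_line : forall s d, exists p : {poly C}, forall u, G (s + u *: d) = p.[u];
  stable_slice : forall s i, exists2 p : {poly C}, (size p <= n.+1)%N &
    forall u, G (s + u *: dirmx i) = p.[u] /\
      color_shift G i (s + u *: dirmx i) = p.[u] - kappa i / n%:R * p^`().[u];
  stable_conj : forall s, G (map_mx Num.conj s) = (G s)^*;
  stable_neq0 : forall s, (forall l j, 0 < 'Im (s l j)) -> G s != 0 }.

Lemma color_shiftC G i j s :
  color_shift (color_shift G i) j s = color_shift (color_shift G j) i s.
Proof.
rewrite /color_shift; congr (_ * _); rewrite -!mulr_sumr; congr (_ * _).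
rewrite exchange_big; apply: eq_bigr => l _; apply: eq_bigr => m _.
by rewrite addrAC.
Qed.

Let Im_sqr_norm (x : C) : 'Im (`|x| ^+ 2) = 0.
Proof. by apply/Creal_ImP; rewrite rpredX ?normr_real. Qed.

Let c_ge0 i : 0 < kappa i / n%:R.
Proof. by rewrite divr_gt0 // ltr0Sn. Qed.

Lemma stable_color_shift G i :
  stable_functional G -> stable_functional (color_shift G i).
Proof.
move=> [H1 H2 H3 H4]; split.
- move=> s d; have [f Hf] := fin_all_exists (fun l : 'I_n =>
    H1 (s - kappa i *: delta_mx l i) d).
  exists (n%:R^-1 *: \sum_(l < n) f l) => u.
  rewrite hornerZ horner_sum; congr (_ * _); apply: eq_bigr => l _.
  by rewrite addrAC Hf.
- move=> s j; have [f Hf] := fin_all_exists (fun l : 'I_n =>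
    let: ex_intro2 p sp Hp := H2 (s - kappa i *: delta_mx l i) j in
    ex_intro (fun p : {poly C} => (size p <= n.+1)%N /\ forall u : C, _)
      p (conj sp Hp)).
  exists (n%:R^-1 *: \sum_(l < n) f l) => [|u].
    apply: leq_trans (size_scale_leq _ _) _.
    apply: leq_trans (size_sum _ _ _) _; apply/bigmax_leqP => l _.
    by have [] := Hf l.
  split.
    rewrite hornerZ horner_sum; congr (_ * _); apply: eq_bigr => l _.
    by have [_ /(_ u)[<- _]] := Hf l; rewrite addrAC.
  rewrite color_shiftC {1}/color_shift derivZ !hornerZ mulrCA -mulrBr.
  congr (_ * _); rewrite raddf_sum /= !horner_sum mulr_sumr -sumrB.
  apply: eq_bigr => l _.
  by have [_ /(_ u)[_ <-]] := Hf l; rewrite addrAC.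
- move=> s; rewrite /color_shift rmorphM /= fmorphV rmorph_nat rmorph_sum /=.
  congr (_ * _); apply: eq_bigr => l _; rewrite -H3; congr (G _).
  apply/matrixP => a b; rewrite !mxE rmorphB rmorphM /= rmorph_nat.
  by rewrite (CrealP (gtr0_real (kappa_gt0 i))).
move=> s Hs; have [p sp Hp] := H2 s i.
have [p0 q0] := Hp 0; rewrite scale0r addr0 in p0 q0; rewrite q0.
have [u u0||] := @Im_logderiv_lt0 C p.
- have [<- _] := Hp u; apply: H4 => l j; rewrite !mxE raddfD /=.
  case: eqP => _; rewrite ?mulr1 ?mulr0 ?raddf0 ?addr0 //.
  exact: ltr_wpDr.
- by move=> ->; rewrite horner0 mulr0 subr0 -p0 H4.
(* A zero would mean p(0) = c p'(0), so that p'(0) conj(p(0)) would be real. *)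
set c := _ / _ => im0; apply: contraTneq im0 => /eqP; rewrite subr_eq0 => /eqP pE.
rewrite -real_leNgt ?real0 ?Creal_Im // -(pmulr_rge0 _ (c_ge0 i)) -/c.
by rewrite -ImMl ?gtr0_real ?c_ge0 // mulrA -pE -normCK Im_sqr_norm.
Qed.

Definition realmx s := forall l j, s l j \is Num.real.

(** After all coordinates are raised by e 'i the quotient of the two values is 1 - (kappa j / n)
    p'/p, where Im (p'/p) <= 0; then e tends to 0. *)
Lemma stable_Im_ge0 G s i j (u : C) : stable_functional G -> realmx s ->
  0 < 'Im u ->
  0 <= 'Im (color_shift G j (s + u *: dirmx i) * (G (s + u *: dirmx i))^* ).
Proof.
move=> HG sr u0; have HGj := stable_color_shift j HG.
have [g Hg] := stable_line HG (s + u *: dirmx i) (const_mx 'i).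
have [h Hh] := stable_line HGj (s + u *: dirmx i) (const_mx 'i).
have := Hg 0; have := Hh 0; rewrite scale0r addr0 => -> ->.
rewrite conj_horner_real ?real0 // -hornerM; apply: Im_horner_ge0_lim => e e0.
rewrite hornerM -conj_horner_real ?gtr0_real // -Hg -Hh.
set t := s + _ + _.
have t0 l k : 0 < 'Im (t l k).
  rewrite !mxE !raddfD /= (Creal_ImP _ (sr l k)) add0r ImMr ?realn //.
  rewrite ImMl ?gtr0_real // Im_i mulr1; apply: ltr_wpDl => //.
  by rewrite mulr_ge0 ?ler0n // ltW.
clearbody t; have [p sp Hp] := stable_slice HG t j.
have [p0 q0] := Hp 0; rewrite scale0r addr0 in p0 q0; rewrite p0 q0.
have [v v0||] := @Im_logderiv_lt0 C p.
- have [<- _] := Hp v; apply: (stable_neq0 HG) => l k; rewrite !mxE raddfD /=.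
  apply: ltr_wpDr => //; case: eqP => _; rewrite ?mulr1 //.
  by rewrite mulr0 raddf0.
- by move=> ->; rewrite horner0 mulr0 subr0 -normCK Im_sqr_norm.
move=> im0; rewrite mulrBl raddfB /= -normCK Im_sqr_norm.
rewrite sub0r -(mulrA (kappa j / n%:R)) ImMl ?(gtr0_real (c_ge0 j)) // oppr_ge0.
by rewrite pmulr_rle0 ?c_ge0 // ltW.
Qed.

(** This is Hurwitz's theorem in quantitative form. At the raised points G is bounded by M times its
    value after the move by u, with M independent of e, so the inequality survives in the limit. *)
Lemma stable_upper_neq0 G s i (u : C) : stable_functional G -> realmx s ->
  G s != 0 -> 0 < 'Im u -> G (s + u *: dirmx i) != 0.
Proof.
move=> HG sr Gs u0.
have [g Hg] := stable_line HG s (const_mx 'i).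
have [h Hh] := stable_line HG (s + u *: dirmx i) (const_mx 'i).
pose M := (1 + `|u| / 'Im u) ^+ n.
have M0 : 0 <= M by rewrite exprn_ge0 // addr_ge0 // divr_ge0 // ltW.
have : `|g.[0]| <= M * `|h.[0]|.
  apply: norm_horner_le_lim => // e e0; rewrite -Hg -Hh addrAC.
  set t := s + _.
  have t0 l k : 0 < 'Im (t l k).
    rewrite !mxE raddfD /= (Creal_ImP _ (sr l k)) add0r.
    by rewrite ImMl ?gtr0_real // Im_i mulr1.
  clearbody t; have [p sp Hp] := stable_slice HG t i.
  have [p0 _] := Hp 0; rewrite scale0r addr0 in p0; have [pu _] := Hp u.
  rewrite p0 pu; apply: horner0_le_upper => // v v0.
  have [<- _] := Hp v; apply: (stable_neq0 HG) => l k; rewrite !mxE raddfD /=.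
  apply: ltr_wpDr => //; case: eqP => _; rewrite ?mulr1 //.
  by rewrite mulr0 raddf0.
rewrite -Hg -Hh !scale0r !addr0; apply: contraTneq => ->.
by rewrite normr0 mulr0 normr_le0.
Qed.

(** By stability and conjugation the zeros of G on the line through s in direction i are real, and
    by hypothesis they are negative. So [real_rooted_barrier] applies with p and r the restrictions
    of G and [color_shift G j]: the ratio of r to p grows along the line, and under the stated bound
    a move by t makes up for the operator in direction i. *)
Lemma stable_barrier G s i j : stable_functional G -> realmx s ->
  (forall t, 0 <= t -> G (s + t *: dirmx i) != 0) -> 0 < G s ->
  let rho := color_shift G j s / G s in
  (forall t, 0 <= t -> 0 < G (s + t *: dirmx i) /\
     rho * G (s + t *: dirmx i) <= color_shift G j (s + t *: dirmx i)) /\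
  (forall t, 0 < t ->
     kappa i / n%:R / t * G (s + t *: dirmx i) <=
       color_shift G i (s + t *: dirmx i) ->
     rho * color_shift G i (s + t *: dirmx i) <=
       color_shift (color_shift G j) i (s + t *: dirmx i)).
Proof.
move=> HG sr Gt Gs rho; have HGj := stable_color_shift j HG.
have [p _ Hp] := stable_slice HG s i; have [r _ Hr] := stable_slice HGj s i.
have realE H (q : {poly C}) : stable_functional H ->
    (forall u, H (s + u *: dirmx i) = q.[u]) -> real_poly q.
  move=> HH Hq; apply: poly_ext => x; rewrite -{1}(conjCK x) horner_map /= -!Hq.
  rewrite -(stable_conj HH); congr (H _); apply/matrixP => l k; rewrite !mxE.
  rewrite rmorphD rmorphM /= conjCK rmorph_nat; congr (_ + _).
  exact/CrealP.
have rr : real_poly r by apply: (realE _ r HGj) => u; have [] := Hr u.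
have pr : real_poly p by apply: (realE _ p HG) => u; have [] := Hp u.
have pE u : p.[u] = G (s + u *: dirmx i) by have [] := Hp u.
have rE u : r.[u] = color_shift G j (s + u *: dirmx i) by have [] := Hr u.
have p0E : p.[0] = G s by rewrite pE scale0r addr0.
have r0E : r.[0] = color_shift G j s by rewrite rE scale0r addr0.
have proots u : p.[u] = 0 -> u < 0.
  move=> pu0; have uu v : p.[v] = 0 -> 'Im v <= 0.
    move=> pv; rewrite real_leNgt ?Creal_Im ?real0 //; apply/negP => v0.
    have := stable_upper_neq0 i HG sr _ v0; rewrite gt_eqF // -pE pv eqxx.
    by move/(_ isT).
  have ur : u \is Num.real.
    apply/Creal_ImP/le_anti; rewrite uu //= -oppr_le0 -Im_conj uu //.
    by rewrite -[p in LHS]pr horner_map /= pu0 conjC0.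
  rewrite real_ltNge ?real0 //; apply/negP => /Gt; rewrite -pE pu0 eqxx //.
have [|u u0|HM HC] := real_rooted_barrier rr proots; rewrite ?p0E //.
  by rewrite rE pE; apply: stable_Im_ge0.
rewrite p0E r0E -/rho in HM HC; split=> t t0.
  have [p1 q1] := HM t t0; rewrite -pE; split=> //.
  by move: q1; rewrite hornerD hornerN hornerZ subr_ge0 -rE.
have [_ ->] := Hp t; have [_ ->] := Hr t; rewrite -pE => bar.
rewrite -subr_ge0; have := HC t _ t0 (ltW (c_ge0 i)) bar.
rewrite derivB derivZ !(hornerD, hornerN, hornerZ).
by congr (_ <= _); ring.
Qed.
End StableFunctionals.

(** * The barrier argument *)

Section BarrierInduction.
Variables (C : numClosedFieldType) (n' N : nat) (kappa : 'I_N -> C).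
Local Notation n := n'.+1.
Hypothesis kappa_gt0 : forall i, 0 < kappa i.
Variables (t : C) (act : pred 'I_N) (th : 'I_N -> C).
Hypothesis t_gt0 : 0 < t.
Hypothesis th_gt0 : forall j, 0 < th j.
Hypothesis th_act : forall j, act j -> th j = kappa j / n%:R / t.
Implicit Types (G : 'M[C]_(n, N) -> C) (K : seq 'I_N) (z : 'I_N -> C).

Local Notation shift := (color_shift kappa).

Definition color_shifts G K := foldr (fun i H => shift H i) G K.

Definition diagpt z : 'M[C]_(n, N) := \matrix_(l, j) z j.

Definition pending K (j : 'I_N) := act j && (j \notin K).

(** An active coordinate waits at or above -t until its operator is applied and is 0 afterwards; an
    inactive one is always 0. *)
Definition barrier_dom K z := forall j,
  z j \is Num.real /\ if pending K j then - t <= z j else z j == 0.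

Definition barrier_base K (j : 'I_N) : C := if pending K j then - t else 0.

(** Since [shift G j / G] is 1 - (kappa j / n) times the logarithmic derivative in direction j, the
    second clause is an upper bound for the barrier functions; the first says that the base point
    lies above the zeros of G. *)
Definition barrier_inv G K :=
  (forall z, barrier_dom K z -> 0 < G (diagpt z)) /\
  (forall j, j \notin K -> th j * G (diagpt (barrier_base K)) <=
                            shift G j (diagpt (barrier_base K))).

Lemma barrier_base_dom K : barrier_dom K (barrier_base K).
Proof.
move=> j; rewrite /barrier_base; case: ifP => _; rewrite ?real0 ?eqxx //.
by rewrite rpredN gtr0_real.
Qed.

Lemma diagpt_real K z : barrier_dom K z -> realmx (diagpt z).
Proof. by move=> zd l j; rewrite mxE; case: (zd j). Qed.

(* The ratio shift G j / G increases along each coordinate direction; move from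
   the base point to z one coordinate at a time. *)
Lemma barrier_mono G K z j : stable_functional kappa G -> barrier_inv G K ->
  barrier_dom K z -> j \notin K -> th j * G (diagpt z) <= shift G j (diagpt z).
Proof.
move=> HG [I1 I2] zd jK.
pose w m (k : 'I_N) := if (k < m)%N then z k else barrier_base K k.
have wd m : barrier_dom K (w m).
  by move=> k; rewrite /w; case: ifP => _; [apply: zd | apply: barrier_base_dom].
suff H m : (m <= N)%N -> th j * G (diagpt (w m)) <= shift G j (diagpt (w m)).
  have := H N (leqnn N); congr (_ * G _ <= shift G j _);
    by apply/matrixP => l k; rewrite !mxE /w ltn_ord.
elim: m => [_|m IH mN].
  have -> : diagpt (w 0%N) = diagpt (barrier_base K).
    by apply/matrixP => l k; rewrite !mxE.
  exact: I2.
have {}IH := IH (ltnW mN); pose k0 := Ordinal mN.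
have E : diagpt (w m.+1) =
    diagpt (w m) + (z k0 - barrier_base K k0) *: dirmx C n' k0.
  apply/matrixP => l k; rewrite !mxE /w ltnS leq_eqVlt.
  have -> : (k == m :> nat) = (k == k0) by [].
  case: eqVneq => [->|_] /=; first by rewrite ltnn mulr1 addrCA subrr addr0.
  by rewrite mulr0 addr0.
have [pk|npk] := boolP (pending K k0); last first.
  have [_] := zd k0; rewrite (negPf npk) => /eqP z0.
  by rewrite E z0 /barrier_base (negPf npk) subrr scale0r addr0.
have s0 : 0 <= z k0 - barrier_base K k0.
  rewrite subr_ge0 /barrier_base pk.
  by have [_] := zd k0; rewrite pk.
have Gw : 0 < G (diagpt (w m)) by apply: I1.
have [u u0|HM _] := stable_barrier kappa_gt0 j HG (diagpt_real (wd m)) (i := k0) _ Gw.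
  rewrite gt_eqF //; have -> : diagpt (w m) + u *: dirmx C n' k0 =
      diagpt (fun k => w m k + u * (k == k0)%:R).
    by apply/matrixP => l k; rewrite !mxE.
  apply: I1 => k; have [wr wk] := wd m k; split.
    by rewrite rpredD // rpredM ?ger0_real // realn.
  case: (eqVneq k k0) wk => [->|_]; last by rewrite mulr0 addr0.
  by rewrite pk mulr1 => wk; rewrite ler_wpDr.
rewrite E; have [p1 p2] := HM _ s0; apply: le_trans p2.
by rewrite ler_pM2r // ler_pdivlMr.
Qed.

(** The value kappa i / n / t of [th i] is exactly the threshold of [stable_barrier] for a move by
    t, so the move of coordinate i from -t to 0 preserves every other [th j]. *)
Lemma barrier_step G K i : stable_functional kappa G -> barrier_inv G K ->
  pending K i -> barrier_inv (shift G i) (i :: K).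
Proof.
move=> HG Hinv pi; have [I1 I2] := Hinv; have /andP[ai iK] := pi.
have sub z : barrier_dom (i :: K) z -> barrier_dom K z.
  move=> zd k; have [zr zb] := zd k; split=> //; move: zb.
  rewrite /pending inE negb_or; case: eqVneq => [->|_] //=.
  by rewrite andbF -/(pending K i) pi => /eqP ->; rewrite oppr_le0 ltW.
have pos z : barrier_dom (i :: K) z -> 0 < shift G i (diagpt z).
  move=> /sub zd; apply: lt_le_trans (barrier_mono HG Hinv zd iK).
  by rewrite mulr_gt0 // I1.
split=> // j; rewrite inE negb_or => /andP[ji jK].
have E : diagpt (barrier_base (i :: K)) =
    diagpt (barrier_base K) + t *: dirmx C n' i.
  apply/matrixP => l k; rewrite !mxE /barrier_base /pending inE negb_or.
  case: eqVneq => [->|_] /=; last by rewrite mulr0 addr0.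
  by rewrite andbF -/(pending K i) pi mulr1 addNr.
have base_dom := barrier_base_dom (i :: K).
have G0 : 0 < G (diagpt (barrier_base K)) by apply/I1/barrier_base_dom.
have [u u0|_ HC] := stable_barrier kappa_gt0 j HG
    (diagpt_real (barrier_base_dom K)) (i := i) _ G0.
  rewrite gt_eqF //; have -> : diagpt (barrier_base K) + u *: dirmx C n' i =
      diagpt (fun k => barrier_base K k + u * (k == i)%:R).
    by apply/matrixP => l k; rewrite !mxE.
  apply: I1 => k; have [wr wk] := barrier_base_dom K k; split.
    by rewrite rpredD // rpredM ?ger0_real // realn.
  case: (eqVneq k i) wk => [->|_]; last by rewrite mulr0 addr0.
  by rewrite pi mulr1 => wk; rewrite ler_wpDr.
rewrite color_shiftC E; apply: le_trans (HC t t_gt0 _).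
  rewrite ler_pM2r; last by rewrite -E; apply: pos.
  by rewrite ler_pdivlMr // I2.
by rewrite -E -th_act //; apply: (barrier_mono HG Hinv (sub _ base_dom) iK).
Qed.

Lemma stable_color_shifts G K :
  stable_functional kappa G -> stable_functional kappa (color_shifts G K).
Proof. by move=> HG; elim: K => //= i K; apply: stable_color_shift. Qed.

Lemma barrier_induction G K : stable_functional kappa G -> barrier_inv G [::] ->
  uniq K -> all act K -> barrier_inv (color_shifts G K) K.
Proof.
move=> HG H0; elim: K => //= i K IH /andP[iK uK] /andP[ai aK].
apply: barrier_step; rewrite /pending ?ai //; last exact: IH.
exact: stable_color_shifts.
Qed.

End BarrierInduction.

(** * Determinants and positive forms *)

Section Determinants.
Variable R : comNzRingType.

(** Sylvester's identity: both sides arise from one block matrix X, multiplied on the left or on the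
    right by a unitriangular Y. *)
Lemma det_1addM_comm m n (A : 'M[R]_(m, n)) (B : 'M[R]_(n, m)) :
  \det (1%:M + A *m B) = \det (1%:M + B *m A).
Proof.
pose X := block_mx 1%:M (- A) B 1%:M.
pose Y := block_mx 1%:M A 0 1%:M : 'M[R]_(m + n).
have Y1 : \det Y = 1 by rewrite det_ublock !det1 mulr1.
have <- : \det (Y *m X) = \det (1%:M + A *m B).
  rewrite mulmx_block !mul1mx !mul0mx mulmx1 !add0r addNr.
  by rewrite det_lblock det1 mulr1.
have <- : \det (X *m Y) = \det (1%:M + B *m A).
  rewrite mulmx_block !mul1mx !mulmx1 !mulmx0 !addr0 addrN.
  by rewrite det_lblock det1 mul1r addrC.
by rewrite !det_mulmx mulrC.
Qed.

Lemma det_1add_mul_diag n (z : 'rV[R]_n) (M : 'M[R]_n) i (u : R) :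
  \det (1%:M + diag_mx (z + u *: delta_mx 0 i) *m M) =
  \det (1%:M + diag_mx z *m M) + u * (\det (1%:M + diag_mx (z + delta_mx 0 i) *m M) -
     \det (1%:M + diag_mx z *m M)).
Proof.
have E w : forall k l, (1%:M + diag_mx w *m M) k l = (k == l)%:R + w 0 k * M k l.
  move=> k l; rewrite !mxE (bigD1 k) //= !mxE eqxx mulr1n big1 ?addr0 // => j jk.
  by rewrite !mxE eq_sym (negPf jk) mulr0n mul0r.
rewrite (@determinant_multilinear _ _ _ (1%:M + diag_mx z *m M)
  (1%:M + diag_mx (z + delta_mx 0 i) *m M) i (1 - u) u); first by ring.
- apply/rowP => l; rewrite [RHS]mxE [X in _ = X + _]mxE [X in _ = _ + X]mxE.
  by rewrite ![row _ _ _ _]mxE !E !mxE !eqxx /=; ring.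
- apply/matrixP => k l; rewrite mxE [RHS]mxE !E !mxE eqxx /=.
  by rewrite [lift i k == i]eq_sym (negPf (neq_lift _ _)) ?mulr0 addr0.
- apply/matrixP => k l; rewrite mxE [RHS]mxE !E !mxE eqxx /=.
  by rewrite [lift i k == i]eq_sym (negPf (neq_lift _ _)) ?mulr0 addr0.
Qed.

(* The Schur complement of the last coordinate. *)
Lemma det_1add_bordered n (z : 'rV[R]_n) (y : R) (M : 'M[R]_n) (b : 'cV[R]_n)
    (c : 'rV[R]_n) :
  \det (1%:M + diag_mx (row_mx z y%:M) *m block_mx M b c 0) =
  \det (1%:M + diag_mx z *m (M - y *: (b *m c))).
Proof.
have -> : diag_mx (row_mx z y%:M) = block_mx (diag_mx z) 0 0 (y%:M : 'M[_]_1).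
  by rewrite diag_mx_row; congr block_mx; apply/matrixP => i j;
    rewrite !mxE !ord1 eqxx.
rewrite mulmx_block !mul0mx !mulmx0 !addr0 !add0r mul_scalar_mx.
have -> : (1%:M : 'M[R]_(n + 1)) = block_mx 1%:M 0 0 1%:M by rewrite scalar_mx_block.
rewrite add_block_mx !add0r addr0.
pose L := block_mx 1%:M 0 (- (y *: c)) 1%:M : 'M[R]_(n + 1).
have HL (X : 'M[_]_(n + 1)) : \det X = \det (X *m L).
  by rewrite det_mulmx det_lblock !det1 !mulr1.
rewrite HL mulmx_block !mulmx1 !mulmx0 mul1mx subrr.
rewrite det_ublock add0r det1 mulr1 mulmxN -scalemxAr -mulmxA -addrA.
by rewrite scalemxAr -mulmxBr.
Qed.
End Determinants.

(** * Positive semidefinite hermitian forms *)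

Section PositiveForms.
Variable C : numClosedFieldType.

Definition adjmx m n (A : 'M[C]_(m, n)) : 'M[C]_(n, m) := (map_mx Num.conj A)^T.

Lemma adjmxK m n (A : 'M[C]_(m, n)) : adjmx (adjmx A) = A.
Proof. by apply/matrixP => i j; rewrite !mxE conjCK. Qed.

Lemma adjmxM m n p (A : 'M[C]_(m, n)) (B : 'M[C]_(n, p)) :
  adjmx (A *m B) = adjmx B *m adjmx A.
Proof. by rewrite /adjmx map_mxM trmx_mul. Qed.

Lemma adjmxD m n (A B : 'M[C]_(m, n)) : adjmx (A + B) = adjmx A + adjmx B.
Proof. by rewrite /adjmx map_mxD linearD. Qed.

Lemma adjmxN m n (A : 'M[C]_(m, n)) : adjmx (- A) = - adjmx A.
Proof. by rewrite /adjmx map_mxN linearN. Qed.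

Lemma adjmxZ m n (a : C) (A : 'M[C]_(m, n)) : adjmx (a *: A) = a^* *: adjmx A.
Proof. by rewrite /adjmx map_mxZ linearZ. Qed.

Lemma adjmx1 n : adjmx (1%:M : 'M[C]_n) = 1%:M.
Proof. by rewrite /adjmx map_mx1 trmx1. Qed.

Definition qform n (M : 'M[C]_n) (v w : 'rV[C]_n) : C := (v *m M *m adjmx w) 0 0.

(** Semidefinite only: Gram matrices of dependent vectors are singular. *)
Definition posdef n (M : 'M[C]_n) := adjmx M = M /\ forall v, 0 <= qform M v v.

Lemma qformDl n (M : 'M[C]_n) u v w : qform M (u + v) w = qform M u w + qform M v w.
Proof. by rewrite /qform !mulmxDl mxE. Qed.

Lemma qformZl n (M : 'M[C]_n) a v w : qform M (a *: v) w = a * qform M v w.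
Proof. by rewrite /qform -!scalemxAl mxE. Qed.

Lemma qform_conj n (M : 'M[C]_n) v w : adjmx M = M ->
  qform M w v = (qform M v w)^*.
Proof.
move=> MM; rewrite /qform; transitivity ((adjmx (v *m M *m adjmx w)) 0 0).
  by rewrite !adjmxM adjmxK MM mulmxA.
by rewrite !mxE.
Qed.

Lemma qformE n (M : 'M[C]_n) v w : qform M v w = \sum_i (v *m M) 0 i * (w 0 i)^*.
Proof. by rewrite /qform mxE; apply: eq_bigr => i _; rewrite !mxE. Qed.

Lemma qform1E n (v : 'rV[C]_n) : qform 1%:M v v = \sum_i `|v 0 i| ^+ 2.
Proof.
by rewrite qformE mulmx1; apply: eq_bigr => i _; rewrite normCK.
Qed.

Lemma qformDm n (M P : 'M[C]_n) v w : qform (M + P) v w = qform M v w + qform P v w.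
Proof. by rewrite /qform mulmxDr mulmxDl mxE. Qed.

Lemma qformZm n a (M : 'M[C]_n) v w : qform (a *: M) v w = a * qform M v w.
Proof. by rewrite /qform -scalemxAr -scalemxAl mxE. Qed.

Lemma qformNm n (M : 'M[C]_n) v w : qform (- M) v w = - qform M v w.
Proof. by rewrite /qform mulmxN mulNmx mxE. Qed.

Lemma qform_outer n (b : 'cV[C]_n) v :
  qform (b *m adjmx b) v v = `|(v *m b) 0 0| ^+ 2.
Proof.
rewrite /qform mulmxA -mulmxA -adjmxM [v *m b]mx11_scalar mul_scalar_mx mxE.
by rewrite normCK !mxE eqxx mulr1n.
Qed.

Lemma qform_CauchySchwarz n (M : 'M[C]_n) v w : posdef M ->
  `|qform M v w| ^+ 2 <= qform M v v * qform M w w.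
Proof.
move=> [MM M0]; set x := qform M v w; set a := qform M v v; set d := qform M w w.
have wv : qform M w v = x^* by rewrite qform_conj.
have expand (l k : C) : 0 <= `|l| ^+ 2 * a + l * k^* * x + (l * k^* * x)^* + `|k| ^+ 2 * d.
  have := M0 (l *: v + k *: w); congr (_ <= _).
  rewrite qformDl !qformZl ![qform M _ (_ + _)]qform_conj // !qformDl !qformZl.
  rewrite -/x -/a wv -/d !rmorphD !rmorphM /= conjCK !normCK.
  have ar : a^* = a by apply/CrealP/ger0_real/M0.
  have dr : d^* = d by apply/CrealP/ger0_real/M0.
  by rewrite ar dr conjCK; ring.
have a0 : 0 <= a := M0 v.
have d0 : 0 <= d := M0 w.
have ger (y : C) : 0 <= y -> y \is Num.real by exact: ger0_real.
(* As d may vanish, the usual coefficients d and - x are replaced by d + e and - x, and e tends to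
   0. *)
rewrite -subr_le0; apply: (@le0_of_le_linear _ _ a) => // [|e e0 _].
  by rewrite rpredB ?ger ?exprn_ge0 ?mulr_ge0.
have D0 : 0 < d + e by rewrite ltr_wpDl.
have Dr : (d + e)^* = d + e by apply/CrealP/gtr0_real.
have := expand (d + e) (- x).
rewrite rmorphN !rmorphM rmorphN /= conjCK Dr normrN (gtr0_norm D0) normCK => H.
rewrite lerBlDr -mulrDr addrC -(ler_pM2l D0) -subr_ge0.
apply: le_trans H _; rewrite -subr_ge0.
have -> : (d + e) * (a * (d + e)) - (d + e) * (x * x^* ) - ((d + e) ^+ 2 * a +
  (d + e) * - x^* * x + (d + e) * - x * x^* + x * x^* * d) = e * (x * x^* ) by ring.
by rewrite -normCK mulr_ge0 ?exprn_ge0 // ltW.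
Qed.

Lemma qform_eq0 n (M : 'M[C]_n) v : posdef M -> qform M v v = 0 -> v *m M = 0.
Proof.
move=> HM v0; have := qform_CauchySchwarz v (v *m M) HM; rewrite v0 mul0r.
move=> H; have {H} : qform M v (v *m M) = 0.
  by apply/eqP; rewrite -normr_eq0 -sqrf_eq0 eq_le H exprn_ge0.
have -> : qform M v (v *m M) = qform 1%:M (v *m M) (v *m M).
  by rewrite /qform mulmx1.
rewrite qform1E => /eqP; rewrite psumr_eq0 => [|i _]; last by rewrite exprn_ge0.
move=> /allP H; apply/rowP => i; rewrite [RHS]mxE.
by have /(_ (mem_index_enum i)) := H i; rewrite sqrf_eq0 normr_eq0 => /eqP.
Qed.

Lemma det_conj_real n (z : 'rV[C]_n) (M : 'M[C]_n) : adjmx M = M ->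
  \det (1%:M + diag_mx (map_mx Num.conj z) *m M) =
  (\det (1%:M + diag_mx z *m M))^*.
Proof.
move=> MM; rewrite -det_map_mx map_mxD map_mxM /= map_mx1 map_diag_mx.
rewrite -[in LHS]MM -det_tr linearD /= trmx1 trmx_mul trmxK tr_diag_mx.
by rewrite det_1addM_comm.
Qed.

(* Writing w = v M, a left null vector v of 1 + M Z satisfies v = - w Z, so
   that the form at v equals - sum_i z_i |w_i|^2. *)
Lemma det_1add_diag_neq0 n (M : 'M[C]_n) (z tau : 'rV[C]_n) (r : C) :
  posdef M -> r < 1 ->
  (forall v, \sum_i tau 0 i * `|(v *m M) 0 i| ^+ 2 <= r * qform M v v) ->
  (forall i, z 0 i \is Num.real) -> (forall i, - tau 0 i <= z 0 i) ->
  \det (1%:M + diag_mx z *m M) != 0.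
Proof.
move=> HM r1 Htau zr zt; rewrite det_1addM_comm; apply/negP => /det0P[v v0 vM].
have vE : v = - (v *m M *m diag_mx z).
  by apply/eqP; rewrite -addr_eq0 -[X in X + _]mulmx1 -mulmxA -mulmxDr vM.
have vi i : v 0 i = - ((v *m M) 0 i * z 0 i).
  by rewrite {1}vE mul_mx_diag mxE [X in - X]mxE.
have qE : qform M v v = - \sum_i z 0 i * `|(v *m M) 0 i| ^+ 2.
  rewrite qformE -sumrN; apply: eq_bigr => i _.
  by rewrite vi rmorphN rmorphM /= (CrealP (zr i)) normCK; ring.
have q0 : qform M v v <= r * qform M v v.
  rewrite {1}qE -sumrN; apply: le_trans (Htau v); apply: ler_sum => i _.
  by rewrite -mulNr ler_wpM2r ?exprn_ge0 // lerNl.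
have {}q0 : qform M v v = 0.
  have q1 := HM.2 v; apply/le_anti; rewrite q1 andbT.
  have : (1 - r) * qform M v v <= 0 by rewrite mulrBl mul1r subr_le0.
  by rewrite pmulr_rle0 ?subr_gt0.
by move: v0; rewrite vE (qform_eq0 HM q0) mul0mx oppr0 eqxx.
Qed.

(** The determinant is 1 at 0 and affine in each coordinate, and by the preceding lemma it does not
    vanish while the coordinates move one at a time from 0 to z. The condition on tau expresses M
    diag(tau) M <= r M, without square roots of M. *)
Lemma det_1add_diag_gt0 n (M : 'M[C]_n) (z tau : 'rV[C]_n) (r : C) :
  posdef M -> r < 1 -> (forall i, 0 <= tau 0 i) ->
  (forall v, \sum_i tau 0 i * `|(v *m M) 0 i| ^+ 2 <= r * qform M v v) ->
  (forall i, z 0 i \is Num.real) -> (forall i, - tau 0 i <= z 0 i) ->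
  0 < \det (1%:M + diag_mx z *m M).
Proof.
move=> HM r1 tau0 Htau zr zt.
pose w m : 'rV[C]_n := \row_k (if (k < m)%N then z 0 k else 0).
suff H m : (m <= n)%N -> 0 < \det (1%:M + diag_mx (w m) *m M).
  have -> : z = w n by apply/rowP => k; rewrite mxE ltn_ord.
  exact: H.
have neq0 := det_1add_diag_neq0 HM r1 Htau.
elim: m => [_|m IH mn].
  have -> : w 0%N = 0 by apply/rowP => k; rewrite !mxE.
  by rewrite raddf0 mul0mx addr0 det1.
have {}IH := IH (ltnW mn); pose k0 := Ordinal mn.
have E : w m.+1 = w m + z 0 k0 *: delta_mx 0 k0.
  apply/rowP => k; rewrite !mxE ltnS leq_eqVlt.
  have -> : (k == m :> nat) = (k == k0) by [].
  case: eqVneq => [->|_] /=; first by rewrite ltnn mulr1 add0r.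
  by rewrite mulr0 addr0.
rewrite E det_1add_mul_diag; set a := \det _ in IH *; set d := _ - a.
have wr m' i : w m' 0 i \is Num.real by rewrite mxE; case: ifP; rewrite ?zr ?real0.
have neq (s : C) : 0 <= s -> s <= 1 -> a + s * (z 0 k0 * d) != 0.
  move=> s0 s1; rewrite mulrA -det_1add_mul_diag; apply: neq0 => i.
    by rewrite mxE rpredD ?wr // !mxE !rpredM ?zr ?realn // ger0_real.
  rewrite !mxE eqxx /=; case: (eqVneq i k0) => [->|_] /=.
    rewrite ltnn add0r mulr1; have [z0|z0] := real_leP (real0 C) (zr k0).
      by apply: le_trans (mulr_ge0 s0 z0); rewrite oppr_le0.
    by apply: le_trans (zt k0) _; rewrite -[leLHS]mul1r ler_wnM2r // ltW.
  rewrite mulr0 addr0; by case: ifP => _; rewrite ?oppr_le0.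
have dr : d \is Num.real.
  have real_det (y : 'rV[C]_n) : (forall i, y 0 i \is Num.real) ->
      \det (1%:M + diag_mx y *m M) \is Num.real.
    move=> yr; apply/CrealP; rewrite -det_conj_real ?HM.1 //.
    by congr (\det (_ + diag_mx _ *m _)); apply/rowP => i; rewrite mxE (CrealP (yr i)).
  rewrite rpredB //; first by apply: real_det => i; rewrite mxE rpredD ?wr // !mxE realn.
  by apply: real_det => i; rewrite wr.
have ar := gtr0_real IH; have zd : z 0 k0 * d \is Num.real by rewrite rpredM.
rewrite real_ltNge ?real0 ?rpredD //; apply/negP => ad.
have X0 : z 0 k0 * d < 0.
  by rewrite -(ltrD2l a) addr0; apply: le_lt_trans ad IH.
(* This is the zero in [0, 1] of the affine function s -> a + s z d, if its value at 1 is not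
   positive. *)
have := neq (- a / (z 0 k0 * d)); rewrite (divfK (ltr0_neq0 X0)) subrr eqxx => Hn.
suff : false by []; apply: Hn.
  by rewrite mulr_le0 ?oppr_le0 ?invr_le0 // ltW.
by rewrite ler_ndivrMr // mul1r -[leRHS]add0r lerBrDr addrC.
Qed.
End PositiveForms.

Lemma deriv_prod_uniq (R : comNzRingType) (J : eqType) (s : seq J)
    (f : J -> {poly R}) : uniq s ->
  (\prod_(l <- s) f l)^`() =
  \sum_(l <- s) (f l)^`() * \prod_(m <- s | m != l) f m.
Proof.
elim: s => [|j s IH] /=; first by rewrite !big_nil derivC.
move=> /andP[js us]; rewrite !big_cons derivM eqxx /= IH //.
have -> : \prod_(m <- s | m != j) f m = \prod_(m <- s) f m.
  rewrite big_seq_cond [RHS]big_seq; apply: eq_bigl => m.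
  by case: (boolP (m \in s)) => //= ms; apply: contraNneq js => <-.
congr (_ + _).
rewrite mulr_sumr [LHS]big_seq [RHS]big_seq; apply: eq_bigr => l ls.
rewrite big_cons mulrCA; case: eqVneq => // jl.
by rewrite jl ls in js.
Qed.

(** * Stability of products of determinants *)

Section DeterminantFunctional.
Variables (C : numClosedFieldType) (n' N : nat) (M : 'M[C]_N).
Local Notation n := n'.+1.

Definition ddet (z : 'rV[C]_N) : C := \det (1%:M + diag_mx z *m M).

Definition color_det (s : 'M[C]_(n, N)) : C := \prod_(l < n) ddet (row l s).

Lemma ddetD (z : 'rV[C]_N) i (u : C) :
  ddet (z + u *: delta_mx 0 i) = ddet z + u * (ddet (z + delta_mx 0 i) - ddet z).
Proof. exact: det_1add_mul_diag. Qed.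

Lemma ddet_line (z d : 'rV[C]_N) :
  exists p : {poly C}, forall u, ddet (z + u *: d) = p.[u].
Proof.
exists (\det (\matrix_(i, j)
  (((i == j)%:R + z 0 i * M i j)%:P + (d 0 i * M i j) *: 'X))) => u.
rewrite -horner_evalE -det_map_mx; congr (\det _); apply/matrixP => i j.
by rewrite mul_diag_mx !mxE /= /horner_eval !hornerE; ring.
Qed.

(** A left null vector satisfies v = - w Z with w = v M. The form at v is real with imaginary part
    sum_i |w_i|^2 Im z_i, so w = 0 and v = 0. *)
Lemma ddet_upper_neq0 (z : 'rV[C]_N) : adjmx M = M ->
  (forall i, 0 < 'Im (z 0 i)) -> ddet z != 0.
Proof.
move=> MM z0; rewrite /ddet det_1addM_comm; apply/negP => /det0P[v v0 vM].
have vE : v = - (v *m M *m diag_mx z).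
  by apply/eqP; rewrite -addr_eq0 -[X in X + _]mulmx1 -mulmxA -mulmxDr vM.
have vi i : v 0 i = - ((v *m M) 0 i * z 0 i).
  by rewrite {1}vE mul_mx_diag mxE [X in - X]mxE.
have : 'Im (qform M v v) = 0.
  by apply/Creal_ImP/CrealP; rewrite -qform_conj.
have -> : 'Im (qform M v v) = \sum_i `|(v *m M) 0 i| ^+ 2 * 'Im (z 0 i).
  rewrite qformE raddf_sum; apply: eq_bigr => i _ /=.
  rewrite vi rmorphN rmorphM /= mulrN mulrA -normCK raddfN /=.
  by rewrite ImMl ?rpredX ?normr_real // Im_conj mulrN opprK.
move=> /eqP; rewrite psumr_eq0 => [/allP H|i _]; last first.
  by rewrite mulr_ge0 ?exprn_ge0 // ltW.
case/eqP: v0; apply/rowP => i; rewrite vi [RHS]mxE.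
have /(_ (mem_index_enum i)) /= := H i.
by rewrite mulf_eq0 (gt_eqF (z0 i)) orbF sqrf_eq0 normr_eq0 => /eqP ->;
  rewrite mul0r oppr0.
Qed.

Lemma row_color_delta (s : 'M[C]_(n, N)) (k : C) (l m : 'I_n) i :
  row m (s - k *: delta_mx l i) =
  row m s + (if m == l then - k else 0) *: delta_mx 0 i.
Proof.
apply/rowP => j; rewrite !mxE eqxx /=; case: (m == l); first by rewrite mulNr.
by rewrite mul0r /= mulr0 subr0 addr0.
Qed.

Lemma color_det_shift (kappa : 'I_N -> C) i (s : 'M[C]_(n, N)) :
  color_shift kappa color_det i s =
  n%:R^-1 * \sum_(l < n) ddet (row l s - kappa i *: delta_mx 0 i) *
                         \prod_(m < n | m != l) ddet (row m s).
Proof.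
congr (_ * _); apply: eq_bigr => l _; rewrite /color_det (bigD1 l) //=.
rewrite row_color_delta eqxx scaleNr; congr (_ * _); apply: eq_bigr => m ml.
by rewrite row_color_delta (negPf ml) scale0r addr0.
Qed.

Lemma stable_color_det (kappa : 'I_N -> C) : adjmx M = M ->
  stable_functional kappa color_det.
Proof.
move=> MM; split.
- move=> s d; have [f Hf] := fin_all_exists (fun l : 'I_n => ddet_line (row l s) (row l d)).
  exists (\prod_(l < n) f l) => u; rewrite horner_prod; apply: eq_bigr => l _.
  by rewrite -Hf !linearE.
- move=> s i; pose a l := ddet (row l s).
  pose b l := ddet (row l s + delta_mx 0 i) - a l.
  pose f l : {poly C} := (a l)%:P + b l *: 'X.
  have rowE l u : row l (s + u *: dirmx C n' i) = row l s + u *: delta_mx 0 i.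
    by apply/rowP => j; rewrite !mxE eqxx.
  have fE l u : ddet (row l (s + u *: dirmx C n' i)) = (f l).[u].
    by rewrite rowE ddetD -/(a l) -/(b l) /f hornerD hornerC hornerZ hornerX mulrC.
  exists (\prod_(l < n) f l).
    apply: leq_trans (size_prod_leq _ _) _.
    rewrite -[#|_|]/(#|'I_n|) card_ord leq_subLR addnS ltnS.
    apply: leq_trans (leq_sum _ (E2 := fun => 2%N) _) _.
      move=> l _; apply: leq_trans (size_polyD _ _) _.
      rewrite geq_max (leq_trans (size_polyC_leq1 _)) //.
      by apply: leq_trans (size_scale_leq _ _) _; rewrite size_polyX.
    by rewrite sum_nat_const card_ord; lia.
  move=> u; split.
    by rewrite horner_prod; apply: eq_bigr => l _; rewrite fE.
  (* Each f l is affine, so shifting its argument by - kappa i is the same as f l - kappa i (f l)';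
     Leibniz's rule assembles the average over l into p - (kappa i / n) p'. *)
  rewrite color_det_shift deriv_prod_uniq ?index_enum_uniq //.
  rewrite horner_sum.
  have -> : (\prod_(l < n) f l).[u] =
      n%:R^-1 * \sum_(l < n) \prod_(m < n) (f m).[u].
    by rewrite sumr_const card_ord -[X in _ * X]mulr_natl mulKf ?horner_prod // pnatr_eq0.
  rewrite [kappa i / _]mulrC -(mulrA n%:R^-1) -mulrBr; congr (_ * _).
  rewrite mulr_sumr -sumrB; apply: eq_bigr => l _.
  rewrite hornerM horner_prod [X in _ = X - _](bigD1 l) //= mulrA -mulrBl.
  rewrite -scaleNr ddetD; congr (_ * _); last by apply: eq_bigr => m _; rewrite fE.
  have -> : (f l)^`().[u] = b l.
    by rewrite /f derivD derivC derivZ derivX add0r hornerZ -[1]/(1%:P) hornerC mulr1.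
  have -> : ddet (row l (s + u *: dirmx C n' i) + delta_mx 0 i) = (f l).[u + 1].
    rewrite rowE -addrA -[X in _ + (_ + X)]scale1r -scalerDl ddetD -/(a l) -/(b l).
    by rewrite /f hornerD hornerC hornerZ hornerX mulrC.
  by rewrite fE /f !(hornerD, hornerC, hornerZ, hornerX); ring.
- move=> s; rewrite /color_det rmorph_prod; apply: eq_bigr => l _ /=.
  by rewrite /ddet -det_conj_real // map_row.
move=> s s0; apply/prodf_neq0 => l _.
by apply: ddet_upper_neq0 => // i; rewrite mxE.
Qed.
End DeterminantFunctional.

(** * Colourings of finite families *)

Section ColoringExtraction.
Variables (C : numClosedFieldType) (n' N : nat) (kappa : 'I_N -> C).
Local Notation n := n'.+1.
Hypothesis kappa_gt0 : forall i, 0 < kappa i.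
Implicit Types (G H : 'M[C]_(n, N) -> C) (s : 'M[C]_(n, N)) (K : seq 'I_N).

Lemma eq_color_shift G H i : G =1 H ->
  color_shift kappa G i =1 color_shift kappa H i.
Proof. by move=> E s; congr (_ * _); apply: eq_bigr => l _; rewrite E. Qed.

Lemma color_shift_shifts G K i :
  color_shift kappa (color_shifts kappa G K) i =1
  color_shifts kappa (color_shift kappa G i) K.
Proof.
elim: K => //= j K IH s; rewrite color_shiftC.
exact: eq_color_shift.
Qed.

Lemma stable_real G s : stable_functional kappa G -> realmx s ->
  G s \is Num.real.
Proof.
move=> HG sr; apply/CrealP; rewrite -(stable_conj HG); congr (G _).
by apply/matrixP => l j; rewrite mxE (CrealP (sr l j)).
Qed.

(** A positive average has a positive summand; this fixes the colours one index at a time. *)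
Lemma color_shifts_choose G K s : stable_functional kappa G -> realmx s ->
  uniq K -> 0 < color_shifts kappa G K s ->
  exists c : 'I_N -> 'I_n, 0 < G (\matrix_(l, j)
    (s l j - if (j \in K) && (l == c j) then kappa j else 0)).
Proof.
move=> HG; elim: K s => [|i K IH] s sr /=.
  move=> _ G0; exists (fun => ord0); congr (0 < G _): G0.
  by apply/matrixP => l j; rewrite mxE /= subr0.
move=> /andP[iK uK] pos.
have s'r l : realmx (s - kappa i *: delta_mx l i).
  by move=> m j; rewrite !mxE rpredB ?sr // rpredM ?realn ?gtr0_real.
have HK := stable_color_shifts kappa_gt0 K HG.
have [l posl] : exists l, 0 < color_shifts kappa G K (s - kappa i *: delta_mx l i).
  apply/existsP; apply: contraLR pos; rewrite negb_exists => /forallP H.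
  rewrite -real_leNgt ?real0 //; last first.
    exact: (stable_real (stable_color_shift kappa_gt0 i HK)).
  rewrite pmulr_rle0 ?invr_gt0 ?ltr0Sn // sumr_le0 // => l _.
  by rewrite real_leNgt ?real0 // (stable_real HK).
have [c cpos] := IH _ (s'r l) uK posl.
exists (fun j => if j == i then l else c j); congr (0 < G _): cpos.
apply/matrixP => m j; rewrite !mxE inE; case: (eqVneq j i) => [->|ji] /=.
  rewrite (negPf iK) /= subr0 andbT; case: eqP => _ /=; first by rewrite mulr1.
  by rewrite mulr0.
by rewrite andbF mulr0 subr0.
Qed.
End ColoringExtraction.

Section FormBounds.
Variable C : numClosedFieldType.

(** M <= m implies M^2 <= m M: with w = v M, Cauchy-Schwarz gives |w|^4 <= M(v, v) M(w, w) <= M(v,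
    v) m |w|^2. *)
Lemma qform1_mulmx_le n (M : 'M[C]_n) (m : C) v : posdef M -> 0 <= m ->
  (forall w, qform M w w <= m * qform 1%:M w w) ->
  \sum_i `|(v *m M) 0 i| ^+ 2 <= m * qform M v v.
Proof.
move=> HM m0 Hm; rewrite -qform1E; set w := v *m M; set x := qform _ _ _.
have x0 : 0 <= x by rewrite /x qform1E sumr_ge0 // => i _; rewrite exprn_ge0.
have := qform_CauchySchwarz v w HM.
have -> : qform M v w = x by rewrite /x /qform mulmx1.
have [->|xn] := eqVneq x 0; first by rewrite mulr_ge0 ?HM.2.
have {}x0 : 0 < x by rewrite lt_neqAle eq_sym xn.
rewrite gtr0_norm // => H; rewrite -(ler_pM2r x0) -expr2; apply: le_trans H _.
by rewrite [m * _]mulrC -mulrA ler_wpM2l ?HM.2 // Hm.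
Qed.

Lemma mulmx_entry_le n (M : 'M[C]_n) v j : posdef M ->
  `|(v *m M) 0 j| ^+ 2 <= M j j * qform M v v.
Proof.
move=> HM; have := qform_CauchySchwarz v (delta_mx 0 j) HM.
have adjd : adjmx (delta_mx 0 j : 'rV[C]_n) = delta_mx j 0.
  by apply/matrixP => i k; rewrite !mxE rmorph_nat andbC.
have E w : qform M w (delta_mx 0 j) = (w *m M) 0 j.
  by rewrite /qform adjd -colE mxE.
by rewrite !E -rowE [row _ _ _ _]mxE [X in _ <= X]mulrC.
Qed.

Lemma mulmx_col_le n (b : 'cV[C]_n) (v : 'rV[C]_n) (e : C) :
  \sum_i `|b i 0| ^+ 2 <= e -> `|(v *m b) 0 0| ^+ 2 <= e * qform 1%:M v v.
Proof.
move=> be; have H1 : posdef (1%:M : 'M[C]_n).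
  split=> [|w]; first exact: adjmx1.
  by rewrite qform1E sumr_ge0 // => i _; rewrite exprn_ge0.
have := qform_CauchySchwarz v (adjmx b) H1.
rewrite {1}/qform mulmx1 adjmxK => /le_trans; apply.
rewrite mulrC ler_wpM2r ?H1.2 //; congr (_ <= _): be; rewrite qform1E.
by apply: eq_bigr => i _; rewrite !mxE norm_conjC.
Qed.

Lemma posdef_add_outer n (M : 'M[C]_n) (b : 'cV[C]_n) (k : C) :
  posdef M -> 0 <= k -> posdef (M + k *: (b *m adjmx b)).
Proof.
move=> HM k0; split=> [|v].
  by rewrite adjmxD adjmxZ adjmxM adjmxK HM.1 (CrealP (ger0_real k0)).
by rewrite qformDm qformZm qform_outer addr_ge0 ?HM.2 // mulr_ge0 ?exprn_ge0.
Qed.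

(** The limit lemma for imaginary parts yields reality when applied to p and - p, and the sign when
    applied to 'i p. *)
Lemma horner_ge0_lim (p : {poly C}) : (forall e, 0 < e -> 0 <= p.[e]) -> 0 <= p.[0].
Proof.
move=> H; have pr e : 0 < e -> 'Im p.[e] = 0.
  by move=> e0; apply/Creal_ImP/ger0_real/H.
have i1 : 0 <= 'Im p.[0] by apply: Im_horner_ge0_lim => e /pr ->.
have i2 : 0 <= 'Im (- p).[0].
  by apply: Im_horner_ge0_lim => e /pr; rewrite hornerN raddfN /= => ->; rewrite oppr0.
have i3 : 0 <= 'Im ('i *: p).[0].
  apply: Im_horner_ge0_lim => e e0; rewrite hornerZ ImMil (Creal_ReP _ _) ?H //.
  exact/ger0_real/H.
move: i2 i3; rewrite hornerN raddfN /= oppr_ge0 hornerZ ImMil => i2.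
by rewrite (Creal_ReP _ _) //; apply/Creal_ImP/le_anti; rewrite i1 i2.
Qed.

(* For e > 0 the matrix of the statement plus e on the selected diagonal
   entries is, up to scaling rows, 1 + Z P with Z >= 0. *)
Lemma det_select_ge0 n (P : 'M[C]_n) (S : pred 'I_n) : posdef P ->
  0 <= \det (1%:M + diag_mx (\row_i (if S i then - 1 else 0)) *m (1%:M - P)).
Proof.
move=> HP; pose A : 'M[{poly C}]_n := \matrix_(i, j)
  (if S i then (i == j)%:R *: 'X + (P i j)%:P else (i == j)%:R%:P).
have AE e : (\det A).[e] = \det (\matrix_(i, j)
    (if S i then (i == j)%:R * e + P i j else (i == j)%:R)).
  rewrite -horner_evalE -det_map_mx; congr (\det _); apply/matrixP => i j.
  by rewrite !mxE /= /horner_eval; case: ifP => _; rewrite !hornerE.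
have -> : \det (1%:M + diag_mx (\row_i (if S i then - 1 else 0)) *m (1%:M - P)) =
    (\det A).[0].
  rewrite AE; congr (\det _); apply/matrixP => i j; rewrite mul_diag_mx !mxE.
  by case: ifP => _; ring.
apply: horner_ge0_lim => e e0; rewrite AE.
pose z : 'rV[C]_n := \row_i (if S i then e^-1 else 0).
pose d : 'rV[C]_n := \row_i (if S i then e else 1).
have -> : \matrix_(i, j) (if S i then (i == j)%:R * e + P i j else (i == j)%:R) =
    diag_mx d *m (1%:M + diag_mx z *m P).
  apply/matrixP => i j; rewrite !mul_diag_mx !mxE; case: ifP => _.
    by rewrite mulrDr mulVKf ?(lt0r_neq0 e0) // mulrC.
  by rewrite mul0r addr0 mul1r.
rewrite det_mulmx det_diag mulr_ge0 //.
  by apply: prodr_ge0 => i _; rewrite mxE; case: ifP => _ //; apply: ltW.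
have ei : 0 <= e^-1 by rewrite invr_ge0 ltW.
apply/ltW/(@det_1add_diag_gt0 _ _ _ _ 0 0) => // [i|v|i|i].
- by rewrite mxE.
- by rewrite mul0r big1 // => i _; rewrite mxE mul0r.
- by rewrite mxE; case: ifP => _; rewrite ?real0 // ger0_real.
by rewrite !mxE oppr0; case: ifP.
Qed.
End FormBounds.

(** The two determinants are the minors on S of P and of P - x b b^* . Their ratio is 1 - x b_S^*
    P_S^-1 b_S, so its positivity bounds b_S^* P_S^-1 b_S by 1/x, and Cauchy-Schwarz for P
    concludes. *)
Lemma select_bound (C : numClosedFieldType) n (P : 'M[C]_n) (b : 'cV[C]_n)
    (S : pred 'I_n) (x : C) (v : 'rV[C]_n) :
  let D := diag_mx (\row_i (if S i then - 1 else 0)) in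
  posdef P -> 0 < x -> 0 < \det (1%:M + D *m (1%:M - P)) ->
  0 < \det (1%:M + D *m (1%:M - P + x *: (b *m adjmx b))) ->
  (forall i, ~~ S i -> v 0 i = 0) ->
  x * `|(v *m b) 0 0| ^+ 2 <= qform P v v.
Proof.
move=> D HP x0 detM detX vS.
set Ms := 1%:M + _ in detM; have Mu : Ms \in unitmx by rewrite unitmxE unitfE gt_eqF.
(* Up to extension by 0 outside S, w is P_S^-1 b_S. *)
pose w := invmx Ms *m (- (D *m b)).
have Mw : Ms *m w = - (D *m b) by rewrite mulKVmx.
clearbody w.
have Dw : D *m w = - w.
  apply/colP => i; rewrite mul_diag_mx !mxE; case: ifP => Si; first by rewrite mulN1r.
  have := congr1 (fun z : 'cV_n => z i 0) Mw.
  rewrite mulmxDl mul1mx -mulmxA !mul_diag_mx.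
  by rewrite !mxE Si !mul0r addr0 oppr0 => ->; rewrite oppr0.
have DPw : D *m P *m w = D *m b.
  apply/oppr_inj; rewrite -Mw /Ms mulmxDl mul1mx mulmxBr mulmx1 mulmxBl Dw.
  by rewrite addrA subrr add0r.
have adjD : adjmx D = D.
  rewrite /adjmx map_diag_mx tr_diag_mx; congr diag_mx; apply/rowP => i.
  by rewrite !mxE; case: ifP; rewrite ?rmorphN ?rmorph1 ?rmorph0.
have bw : (adjmx b *m w) 0 0 = qform P (adjmx w) (adjmx w).
  have wE : w = - (D *m w) by rewrite Dw opprK.
  rewrite /qform adjmxK {1}wE mulmxN mulmxA -{1}adjD -adjmxM -DPw !adjmxM.
  by rewrite HP.1 adjD -!mulmxA Dw !mulmxN opprK.
have q1 : x * qform P (adjmx w) (adjmx w) < 1.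
  move: detX; rewrite mulmxDr addrA -/Ms -scalemxAr mulmxA.
  have -> : Ms + x *: (D *m b *m adjmx b) = Ms *m (1%:M + (- x *: w) *m adjmx b).
    rewrite mulmxDr mulmx1 mulmxA -scalemxAr Mw scaleNr scalerN opprK.
    by rewrite -scalemxAl.
  rewrite det_mulmx pmulr_rgt0 // det_1addM_comm -scalemxAr.
  by rewrite det_mx11 !mxE /= -bw mxE mulNr subr_gt0.
have vD : v = - (v *m D).
  apply/rowP => i; rewrite mul_mx_diag !mxE; case: ifP => Si.
    by rewrite mulrN1 opprK.
  by rewrite vS ?Si // mul0r oppr0.
have -> : v *m b = v *m P *m w.
  by rewrite {1}vD mulNmx -(mulmxA v D) -DPw !mulmxA {2}vD !mulNmx.
have := qform_CauchySchwarz v (adjmx w) HP.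
rewrite {1}/qform adjmxK => CS.
apply: le_trans (_ : x * (qform P v v * qform P (adjmx w) (adjmx w)) <= _).
  by rewrite ler_pM2l.
by rewrite mulrCA ler_piMr ?HP.2 // ltW.
Qed.

(** * The colouring theorem for positive matrices *)

Section FiniteColoring.
Variables (C : numClosedFieldType) (n' N : nat) (P : 'M[C]_N) (b : 'cV[C]_N).
Variables (g e : C).
Local Notation n := n'.+1.
Hypotheses (P_pos : posdef P) (Q_pos : posdef (1%:M - P)).
Hypotheses (g_ge0 : 0 <= g) (g_lt1 : g < 1) (diag_le : forall i, 1 - P i i <= g).
Hypotheses (e_gt0 : 0 < e) (b_le : \sum_i `|b i 0| ^+ 2 <= e).

Let t := (1 - g) / 2.
Hypothesis n_ge : 1 <= n%:R * t ^+ 2.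

Let Q := 1%:M - P.
(* The last coordinate is the variable y of F(z, y), see ddet_row_mx. *)
Let M := block_mx Q b (adjmx b) (0 : 'M[_]_1).
(** With k e = 1/2 one has Q + k b b^* <= 3/2; as t <= 1/2, the determinant is still positive at y =
    - k. *)
Let k := (2 * e)^-1.
Let y : 'I_(N + 1) := rshift N ord0.
Let act : pred 'I_(N + 1) := fun j => j != y.
Let kappa (j : 'I_(N + 1)) : C := if act j then 1 else k.

Let k_gt0 : 0 < k. Proof. by rewrite invr_gt0 mulr_gt0 // ltr0Sn. Qed.

Let kappa_gt0 j : 0 < kappa j.
Proof. by rewrite /kappa; case: ifP. Qed.

Let t_gt0 : 0 < t.
Proof. by rewrite divr_gt0 ?subr_gt0 // ltr0Sn. Qed.

Let t_le : t <= 2^-1.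
Proof. by rewrite /t ler_pdivrMr ?ltr0Sn // mulVf ?pnatr_eq0 // gerBl. Qed.

Let M_herm : adjmx M = M.
Proof.
rewrite /M /adjmx map_block_mx tr_block_mx -/(adjmx Q) -/(adjmx b) Q_pos.1.
by rewrite -/(adjmx (adjmx b)) adjmxK map_mx0 trmx0.
Qed.

Let Q_le1 v : qform Q v v <= qform 1%:M v v.
Proof. by rewrite /Q qformDm qformNm gerBl P_pos.2. Qed.

Let Q_sqr_le v : \sum_i `|(v *m Q) 0 i| ^+ 2 <= qform Q v v.
Proof.
rewrite -[leRHS]mul1r; apply: qform1_mulmx_le => // w.
by rewrite mul1r Q_le1.
Qed.

Lemma ddet_row_mx (z : 'rV[C]_N) (x : C) :
  ddet M (row_mx z x%:M) = \det (1%:M + diag_mx z *m (Q - x *: (b *m adjmx b))).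
Proof. exact: det_1add_bordered. Qed.

Let pos_base (z : 'rV[C]_N) : (forall i, z 0 i \is Num.real) ->
  (forall i, - t <= z 0 i) -> 0 < ddet M (row_mx z (0%:M)).
Proof.
move=> zr zt; rewrite ddet_row_mx scale0r subr0.
apply: (@det_1add_diag_gt0 _ _ _ _ (const_mx t) t) => // [|i|v|i].
- by apply: le_lt_trans t_le _; rewrite invf_lt1 ?ltr0Sn // ltr1n.
- by rewrite mxE ltW.
- rewrite (eq_bigr (fun i => t * `|(v *m Q) 0 i| ^+ 2)) => [|i _]; last by rewrite mxE.
  by rewrite -mulr_sumr ler_wpM2l // ltW.
by rewrite mxE.
Qed.

Let pos_y : 0 < ddet M (row_mx (const_mx (- t)) ((- k)%:M)).
Proof.
rewrite ddet_row_mx scaleNr opprK.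
have HQ := posdef_add_outer b Q_pos (ltW k_gt0).
have ke : k * e = 2^-1 by rewrite /k invfM -mulrA mulVf ?mulr1 // gt_eqF.
apply: (@det_1add_diag_gt0 _ _ _ _ (const_mx t) (t * (1 + k * e))) => // [|i|v|i|i].
- rewrite ke; apply: le_lt_trans (_ : 2^-1 * (1 + 2^-1) < 1).
    by rewrite ler_wpM2r // addr_ge0 // invr_ge0 ler0n.
  by rewrite -subr_gt0 (_ : _ - _ = 4^-1) ?invr_gt0 ?ltr0Sn //; field.
- by rewrite mxE ltW.
- rewrite (eq_bigr (fun i => t * `|(v *m (Q + k *: (b *m adjmx b))) 0 i| ^+ 2)) =>
    [|i _]; last by rewrite mxE.
  rewrite -mulr_sumr -(mulrA t) ler_wpM2l ?(ltW t_gt0) //.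
  apply: qform1_mulmx_le => // [|w].
    by rewrite addr_ge0 // mulr_ge0 // ltW.
  rewrite qformDm qformZm qform_outer mulrDl mul1r lerD ?Q_le1 //.
  by rewrite -(mulrA k) ler_wpM2l ?(ltW k_gt0) // mulmx_col_le.
- by rewrite mxE rpredN gtr0_real.
by rewrite !mxE.
Qed.

Let th := 1 / n%:R / t.

Let th_gt0 : 0 < th.
Proof. by rewrite /th (divr_gt0 (divr_gt0 ltr01 (ltr0Sn _ _)) t_gt0). Qed.

Let th_le : th <= t.
Proof.
rewrite /th ler_pdivrMr // ler_pdivrMr ?ltr0Sn // mulrC -expr2.
exact: n_ge.
Qed.

Let th_lt1 : th < 1.
Proof.
apply: le_lt_trans th_le _; apply: le_lt_trans t_le _.
by rewrite invf_lt1 ?ltr0Sn // ltr1n.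
Qed.

(** The determinant is affine in z_j, so positivity at distance 1/(1 - th) below the base point
    bounds its slope by 1 - th times its value there, which is the barrier condition. The
    requirement t + g/(1 - th) < 1 amounts to g < (1 - th)(1 - t); it holds since th <= t and (1 -
    t)^2 = g + ((1 - g)/2)^2. *)
Let pos_act (j : 'I_N) :
  0 < ddet M (row_mx (const_mx (- t) - (1 - th)^-1 *: delta_mx 0 j) (0%:M)).
Proof.
rewrite ddet_row_mx scale0r subr0; set s := (1 - th)^-1.
have s0 : 0 < s by rewrite invr_gt0 subr_gt0.
pose tau : 'rV[C]_N := const_mx t + s *: delta_mx 0 j.
have tauE i : tau 0 i = t + s * (i == j)%:R by rewrite !mxE eqxx.
apply: (@det_1add_diag_gt0 _ _ _ _ tau (t + s * g)) => // [|i|v|i|i].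
- have h : (1 + g) / 2 <= 1 - th.
    by rewrite lerBrDr addrC -lerBrDr (_ : 1 - _ = t) // /t; field.
  have D0 : 0 < 1 - th by rewrite subr_gt0.
  rewrite -(ltr_pM2r D0) mul1r mulrDl (mulrAC s) /s mulVf ?(gt_eqF D0) // mul1r.
  rewrite -subr_gt0 (_ : _ - _ = (1 - th) * (1 - t) - g); last by ring.
  rewrite subr_gt0; apply: lt_le_trans (_ : (1 + g) / 2 * (1 - t) <= _); last first.
    by rewrite ler_wpM2r // subr_ge0 (le_trans t_le) // invf_le1 ?ltr0Sn // ler1n.
  rewrite -subr_gt0 (_ : _ - _ = ((1 - g) / 2) ^+ 2); last by rewrite /t; field.
  by rewrite exprn_gt0.
- by rewrite !mxE (addr_ge0 (ltW t_gt0)) // mulr_ge0 ?ler0n // ltW.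
- rewrite (eq_bigr (fun i => t * `|(v *m Q) 0 i| ^+ 2 +
    s * ((i == j)%:R * `|(v *m Q) 0 i| ^+ 2))) => [|i _]; last first.
    by rewrite tauE mulrDl (mulrA s).
  rewrite big_split /= -!mulr_sumr mulrDl lerD ?ler_wpM2l ?(ltW t_gt0) //.
  rewrite -(mulrA s) ler_wpM2l ?(ltW s0) // (bigD1 j) //= eqxx mul1r.
  rewrite big1 => [|i /negPf->]; last by rewrite mul0r.
  rewrite addr0; apply: le_trans (mulmx_entry_le _ _ Q_pos) _.
  by rewrite ler_wpM2r ?Q_pos.2 // !mxE eqxx.
- by rewrite !mxE rpredB ?rpredN ?(gtr0_real t_gt0) // (rpredM (gtr0_real s0)) ?realn.
by rewrite !mxE opprD.
Qed.

Let base : 'rV[C]_(N + 1) := row_mx (const_mx (- t)) (0%:M).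
(** With this choice the barrier condition in direction y is an equality at the start; its
    positivity is all that the conclusion needs. *)
Let thy := ddet M (row_mx (const_mx (- t)) ((- k)%:M)) / ddet M base.
Let thf (j : 'I_(N + 1)) : C := if act j then th else thy.

Let base_gt0 : 0 < ddet M base.
Proof. by apply: pos_base => i; rewrite mxE ?rpredN ?gtr0_real. Qed.

Let thf_gt0 j : 0 < thf j.
Proof. by rewrite /thf; case: ifP => _ //; rewrite divr_gt0. Qed.

Let thf_act j : act j -> thf j = kappa j / n%:R / t.
Proof. by move=> aj; rewrite /thf /kappa aj. Qed.

Let lshift_act (i : 'I_N) : act (lshift 1 i).
Proof. by rewrite /act /y -val_eqE /= addn0 neq_ltn ltn_ord. Qed.

Let row_diagpt (z : 'I_(N + 1) -> C) l :
  row l (diagpt n' z) = row_mx (\row_i z (lshift 1 i)) ((z y)%:M).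
Proof.
apply/rowP => j; rewrite !mxE; case: splitP => i ji; rewrite !mxE.
  by congr z; apply/val_inj.
by rewrite !ord1 eqxx mulr1n; congr z; apply/val_inj; rewrite /= ji ord1.
Qed.

Let row_mx_y (z : 'rV[C]_N) (x u : C) :
  row_mx z (x%:M) + u *: delta_mx 0 y = row_mx z ((x + u)%:M).
Proof.
rewrite /y delta_mx_rshift scale_row_mx add_row_mx scaler0 addr0; congr row_mx.
by apply/rowP => i; rewrite !mxE !ord1 /= mulr1.
Qed.

Let inv0 : barrier_inv kappa t act thf (@color_det C n' _ M) [::].
Proof.
split=> [z zd|j _].
  rewrite /color_det prodr_gt0 // => l _; rewrite row_diagpt.
  have -> : z y = 0 by have [_] := zd y; rewrite /pending /act eqxx /= => /eqP.
  apply: pos_base => i; rewrite mxE; have [zr] := zd (lshift 1 i) => //.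
  by rewrite /pending lshift_act.
have rowE l : row l (diagpt n' (barrier_base t act [::])) = base.
  rewrite row_diagpt /barrier_base /pending {2}/act eqxx /=; congr row_mx.
  by apply/rowP => i; rewrite !mxE lshift_act.
(* All rows coincide at the base point, so the average over colours reduces to the claim for a
   single determinant. *)
rewrite color_det_shift; set X := ddet M (base - kappa j *: delta_mx 0 j).
rewrite (eq_bigr (fun=> X * ddet M base ^+ n')) => [|l _]; last first.
  rewrite rowE; congr (_ * _); rewrite (eq_bigr (fun=> ddet M base)) => [|m _].
    by rewrite prodr_const cardC1 card_ord.
  by rewrite rowE.
rewrite sumr_const card_ord -[(X * _) *+ _]mulr_natl mulKf ?pnatr_eq0 //.
rewrite /color_det (eq_bigr (fun=> ddet M base)) => [|l _]; last by rewrite rowE.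
rewrite prodr_const card_ord exprS mulrA ler_pM2r ?exprn_gt0 // /X.
rewrite /thf /kappa; case: ifP => [jy|/negbFE/eqP ->]; last first.
  rewrite /thy divfK ?gt_eqF // le_eqVlt; apply/orP; left; apply/eqP.
  by rewrite /base -scaleNr row_mx_y add0r.
have [i ji] : exists i, j = lshift 1 i.
  case: (split_ordP j) => i ji; first by exists i.
  by move: jy; rewrite /act ji /y (ord1 i) eqxx.
have := pos_act i.
have -> : row_mx (const_mx (- t) - (1 - th)^-1 *: delta_mx 0 i) (0%:M) =
   base + (- (1 - th)^-1) *: delta_mx 0 j.
  by rewrite /base ji delta_mx_lshift scale_row_mx add_row_mx scaleNr scaler0 addr0.
rewrite -scaleNr !ddetD; set B := _ - _ => H.
have D0 : 0 < 1 - th by rewrite subr_gt0.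
move: H; rewrite mulNr subr_gt0 mulrC ltr_pdivrMr // mulrBr mulr1 => /ltW.
by rewrite mulN1r lerBrDr addrC -lerBrDr mulrC.
Qed.

Theorem finite_coloring : exists c : 'I_N -> 'I_n, forall l (v : 'rV[C]_N),
  (forall i, c i != l -> v 0 i = 0) ->
  `|(v *m b) 0 0| ^+ 2 <= 2 * n%:R * e * qform P v v.
Proof.
pose G := @color_det C n' _ M; have HG : stable_functional kappa G by apply: stable_color_det.
pose K := [seq j <- enum 'I_(N + 1) | act j].
have uK : uniq K by rewrite filter_uniq // enum_uniq.
have inK j : (j \in K) = act j by rewrite mem_filter mem_enum andbT.
have aK : all act K by apply/allP => j; rewrite inK.
have [I1 I2] := barrier_induction kappa_gt0 t_gt0 thf_gt0 thf_act HG inv0 uK aK.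
(* The operators commute, so the one in y may come first; the surviving barrier in direction y then
   makes the full average positive. *)
pose Y := color_shift kappa G y.
have HY : stable_functional kappa Y by apply: stable_color_shift.
have posY : 0 < color_shifts kappa Y K (diagpt n' (barrier_base t act K)).
  rewrite -color_shift_shifts; apply: lt_le_trans (I2 y _); last first.
    by rewrite inK /act eqxx.
  by rewrite mulr_gt0 //; apply/I1/barrier_base_dom.
have [|c0 c0pos] := color_shifts_choose kappa_gt0 HY _ uK posY.
  exact/diagpt_real/barrier_base_dom.
pose c i := c0 (lshift 1 i); exists c.
pose Z l : 'rV[C]_N := \row_i (if c i == l then -1 else 0).
(* A l x is the minor of P + x b b^* on the l-th colour class, an affine function of x that is
   nonnegative for x >= 0; hence its slope [be l] is nonnegative. *)
pose A l x := ddet M (row_mx (Z l) (x%:M)).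
have AE l x : A l x = A l 0 + x * (A l 1 - A l 0).
  have E u : row_mx (Z l) (u%:M) = row_mx (Z l) (0%:M) + u *: delta_mx 0 y.
    by rewrite row_mx_y add0r.
  by rewrite /A E ddetD; congr (_ + _ * (_ - _)); rewrite [in RHS]E scale1r.
have Adet l x : A l x = \det (1%:M + diag_mx (Z l) *m (1%:M - (P + x *: (b *m adjmx b)))).
  by rewrite /A ddet_row_mx opprD addrA.
have A_ge0 l x : 0 <= x -> 0 <= A l x.
  move=> x0; rewrite Adet; apply: (det_select_ge0 (fun i => c i == l)).
  exact: posdef_add_outer.
pose be l := A l 1 - A l 0.
have be_ge0 l : 0 <= be l.
  have ger (x : C) : 0 <= x -> x \is Num.real by exact: ger0_real.
  rewrite real_leNgt ?real0 ?rpredB ?ger ?A_ge0 //; apply/negP => b0.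
  have D0 : 0 < - be l by rewrite oppr_gt0.
  have /(A_ge0 l) : 0 <= (A l 0 + 1) / - be l.
    by rewrite divr_ge0 ?(ltW D0) // addr_ge0 ?A_ge0.
  rewrite AE -/(be l) invrN mulrN mulNr divfK ?lt_eqF // opprD addrA subrr add0r.
  by rewrite oppr_ge0 ler10.
have rowS l : row l (\matrix_(l, j) (diagpt n' (barrier_base t act K) l j -
    (if (j \in K) && (l == c0 j) then kappa j else 0))) = row_mx (Z l) (0%:M).
  apply/rowP => j; rewrite !mxE inK /barrier_base /pending inK andbN sub0r.
  case: split_ordP => p ->; rewrite !mxE.
    rewrite lshift_act /kappa lshift_act [l == _]eq_sym /= -/(c p).
    by case: ifP => _; rewrite ?oppr0.
  by rewrite (ord1 p) /act /y !eqxx /= oppr0.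
pose W l := \prod_(m < n | m != l) A m 0.
have prodE l : \prod_(m < n) A m 0 = A l 0 * W l by rewrite (bigD1 l).
have W0 l : 0 <= W l by rewrite prodr_ge0 // => m _; apply: A_ge0.
have sum_gt0 : 0 < \sum_(l < n) (A l 0 - k * be l) * W l.
  move: c0pos; rewrite /Y /G color_det_shift pmulr_rgt0 ?invr_gt0 ?ltr0Sn //.
  congr (0 < _); apply: eq_bigr => l _; rewrite /W; congr (_ * _); last first.
    by apply: eq_bigr => m _; rewrite rowS.
  rewrite rowS -[k * _]opprK -mulNr.
  have := AE l (- k); rewrite -/(be l) mulNr opprK => <-; rewrite /A; congr (ddet M _).
  by rewrite -scaleNr row_mx_y add0r /kappa /act eqxx.
have sumE : \sum_(l < n) (A l 0 - k * be l) * W l =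
    n%:R * \prod_(m < n) A m 0 - k * \sum_(l < n) be l * W l.
  have -> : n%:R * \prod_(m < n) A m 0 = \sum_(l < n) \prod_(m < n) A m 0.
    by rewrite sumr_const card_ord mulr_natl.
  rewrite mulr_sumr -sumrB.
  by apply: eq_bigr => l _; rewrite (prodE l) mulrBl mulrA.
rewrite {}sumE subr_gt0 in sum_gt0.
have beW l : 0 <= be l * W l by rewrite mulr_ge0.
have prod_gt0 : 0 < \prod_(m < n) A m 0.
  have : 0 < n%:R * \prod_(m < n) A m 0.
    by apply: le_lt_trans sum_gt0; rewrite mulr_ge0 ?(ltW k_gt0) // sumr_ge0.
  by rewrite pmulr_rgt0 // ltr0Sn.
have A0_gt0 l : 0 < A l 0.
  rewrite lt_neqAle A_ge0 // andbT eq_sym; apply: contraTneq prod_gt0.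
  by rewrite (prodE l) => ->; rewrite mul0r ltxx.
(* All summands be m * W m are nonnegative, so each one alone obeys the bound for the sum; then W l
   cancels. *)
have kbe l : k * be l < n%:R * A l 0.
  have Wl : 0 < W l by move: prod_gt0; rewrite (prodE l) pmulr_rgt0.
  rewrite -(ltr_pM2r Wl) -!mulrA -prodE; apply: le_lt_trans sum_gt0.
  by rewrite ler_pM2l // (bigD1 l) //= lerDl sumr_ge0.
move=> l v vl.
have kn0 : 0 < k / n%:R by rewrite divr_gt0 ?ltr0Sn.
have detX : 0 < A l (- (k / n%:R)).
  rewrite AE -/(be l) mulNr subr_gt0 mulrAC ltr_pdivrMr ?ltr0Sn //.
  by rewrite [_ * n%:R]mulrC.
have := @select_bound _ _ P b (fun i => c i == l) (k / n%:R) v P_pos kn0.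
rewrite -/(Z l) => /(_ _ _ vl) H.
have {}H : k / n%:R * `|(v *m b) 0 0| ^+ 2 <= qform P v v.
  apply: H.
    by have := A0_gt0 l; rewrite Adet scale0r addr0.
  by have := detX; rewrite Adet scaleNr opprD opprK addrA.
have -> : 2 * n%:R * e = (k / n%:R)^-1.
  by rewrite invf_div /k invrK mulrC mulrA mulrC; ring.
by rewrite -(ler_pM2l kn0) mulVKf // gt_eqF.
Qed.
End FiniteColoring.

(** For v = u + 'i w with u and w real, the cross terms cancel by symmetry. Over real scalars the
    Hilbert space controls real coefficients only, whereas the determinants need complex ones. *)
Lemma posdef_real (C : numClosedFieldType) n (M : 'M[C]_n) : adjmx M = M ->
  (forall i j, M i j \is Num.real) ->
  (forall u : 'rV[C]_n, (forall i, u 0 i \is Num.real) -> 0 <= qform M u u) ->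
  posdef M.
Proof.
move=> MM Mr M0; split=> // v.
pose u : 'rV[C]_n := \row_i 'Re (v 0 i); pose w : 'rV[C]_n := \row_i 'Im (v 0 i).
have ur i : u 0 i \is Num.real by rewrite mxE Creal_Re.
have wr i : w 0 i \is Num.real by rewrite mxE Creal_Im.
have vE : v = u + 'i *: w by apply/rowP => i; rewrite !mxE -Crect.
clearbody u w.
have qr : (qform M u w)^* = qform M u w.
  apply/CrealP; rewrite qformE rpred_sum // => i _.
  rewrite (CrealP (wr i)) rpredM // mxE rpred_sum // => j _.
  by rewrite rpredM.
have qv z : qform M z v = (qform M u z + 'i * qform M w z)^*.
  by rewrite qform_conj // vE qformDl qformZl.
have qwu : qform M w u = qform M u w by rewrite qform_conj.
have qc z : (qform M z z)^* = qform M z z by rewrite -qform_conj.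
have -> : qform M v v = qform M u u + qform M w w.
  rewrite {1}vE qformDl qformZl !qv qwu !rmorphD !rmorphM /= !conjCi qr !qc.
  have -> : 'i * (qform M u w + - 'i * qform M w w) =
     'i * qform M u w - 'i ^+ 2 * qform M w w by ring.
  by rewrite sqrCi; ring.
by rewrite addr_ge0 ?M0.
Qed.

Lemma le_of_sqr_le_mul (F : numDomainType) (x y s : F) : 0 < x ->
  `|x| ^+ 2 <= y * x * s -> x <= y * s.
Proof. by move=> x0; rewrite gtr0_norm // expr2 mulrAC ler_pM2r. Qed.

(** * Gram matrices over real or complex scalars *)

Section GramMatrices.
Variables (R : rcfType) (K : numFieldType) (emb : {rmorphism K -> R[i]%C}).
Variables (H : lmodType K) (ip : H -> H -> K) (nm : H -> R).
Local Notation C := (R[i]%C).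
Local Notation phi x y := (emb (ip x y)).

(* The image of the scalar field is all of C, or the real axis. *)
Hypothesis emb_cases :
  (forall z : C, exists a, emb a = z) \/
  ((forall z : C, z \is Num.real -> exists a, emb a = z) /\
   (forall a, emb a \is Num.real)).
Hypothesis ipDl : forall x y z, ip (x + y) z = ip x z + ip y z.
Hypothesis ipZl : forall a x y, ip (a *: x) y = a * ip x y.
Hypothesis ip_sym : forall x y, phi y x = (phi x y)^*.
Hypothesis ip_nm : forall x, phi x x = ((nm x ^+ 2)%:C)%C.

Let rcM (a c : R) : ((a * c)%:C)%C = (a%:C)%C * (c%:C)%C :> C.
Proof. exact: (rmorphM (real_complex R)). Qed.

Let rcV (a : R) : ((a^-1)%:C)%C = ((a%:C)%C)^-1 :> C.
Proof. exact: (fmorphV (real_complex R)). Qed.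

Let rcB (a c : R) : ((a - c)%:C)%C = (a%:C)%C - (c%:C)%C :> C.
Proof. exact: (rmorphB (real_complex R)). Qed.

Let rcn n : ((n%:R)%:C)%C = n%:R :> C.
Proof. exact: (rmorph_nat (real_complex R)). Qed.

Let rc1 : (1%:C)%C = 1 :> C.
Proof. exact: (rmorph1 (real_complex R)). Qed.

Lemma phi_suml (J : Type) (r : seq J) (Q : pred J) (u : J -> H) y :
  phi (\sum_(j <- r | Q j) u j) y = \sum_(j <- r | Q j) phi (u j) y.
Proof.
have ip0 : ip 0 y = 0 by rewrite -(scale0r (0 : H)) ipZl mul0r.
elim/big_rec2: _ => [|j v w _ <-]; first by rewrite ip0 rmorph0.
by rewrite ipDl rmorphD.
Qed.

Lemma phi_sumr (J : Type) (r : seq J) (Q : pred J) (u : J -> H) y :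
  phi y (\sum_(j <- r | Q j) u j) = \sum_(j <- r | Q j) phi y (u j).
Proof.
rewrite ip_sym phi_suml rmorph_sum; apply: eq_bigr => j _ /=.
by rewrite [in RHS]ip_sym.
Qed.

Lemma phiZl a x y : phi (a *: x) y = emb a * phi x y.
Proof. by rewrite ipZl rmorphM. Qed.

Lemma phiZr a x y : phi x (a *: y) = (emb a)^* * phi x y.
Proof. by rewrite ip_sym phiZl rmorphM /= -ip_sym. Qed.

Lemma posdef_emb n (M : 'M[C]_n) : adjmx M = M ->
  (forall i j, exists a, M i j = emb a) ->
  (forall a : 'I_n -> K, 0 <= qform M (\row_i emb (a i)) (\row_i emb (a i))) ->
  posdef M.
Proof.
move=> MM Memb M0; have [surj|[surj im]] := emb_cases.
  split=> // v; have [a av] := fin_all_exists (fun i => surj (v 0 i)).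
  by have := M0 a; congr (0 <= qform _ _ _); apply/rowP => i; rewrite mxE av.
apply: posdef_real => // [i j|u ur]; first by have [a ->] := Memb i j; apply: im.
have [a au] := fin_all_exists (fun i => surj _ (ur i)).
by have := M0 a; congr (0 <= qform _ _ _); apply/rowP => i; rewrite mxE au.
Qed.

Definition gram n (f : 'I_n -> H) : 'M[C]_n := \matrix_(i, j) phi (f i) (f j).

Lemma qform_gram n (f : 'I_n -> H) (a : 'I_n -> K) :
  qform (gram f) (\row_i emb (a i)) (\row_i emb (a i)) =
  ((nm (\sum_i a i *: f i) ^+ 2)%:C)%C.
Proof.
rewrite -ip_nm qformE phi_sumr; apply: eq_bigr => j _.
rewrite phiZr [X in _ * X^*]mxE mulrC; congr (_ * _); rewrite mxE phi_suml.
by apply: eq_bigr => i _; rewrite !mxE phiZl.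
Qed.

Lemma gram_herm n (f : 'I_n -> H) : adjmx (gram f) = gram f.
Proof. by apply/matrixP => i j; rewrite !mxE -ip_sym. Qed.

(** The dual form of the Bessel inequality: pair L = sum_i a_i f_i with itself, apply Cauchy-Schwarz
    to the coefficients, and cancel |L|^2. *)
Lemma gram_bessel n (f : 'I_n -> H) (B : R) (a : 'I_n -> K) : 0 < B ->
  (forall x, \sum_i `|phi (f i) x| ^+ 2 <= ((B * nm x ^+ 2)%:C)%C) ->
  ((nm (\sum_i a i *: f i) ^+ 2)%:C)%C <= (B%:C)%C * \sum_i `|emb (a i)| ^+ 2.
Proof.
move=> B0 Hb; set L := \sum_i _; pose v : 'rV[C]_n := \row_i emb (a i).
have := @mulmx_col_le _ n (\col_i phi (f i) L) v ((B * nm L ^+ 2)%:C)%C.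
rewrite (eq_bigr (fun i => `|phi (f i) L| ^+ 2)) => [|i _]; last by rewrite mxE.
move=> /(_ (Hb L)).
have -> : (v *m \col_i phi (f i) L) 0 0 = ((nm L ^+ 2)%:C)%C.
  rewrite -ip_nm {1}/L phi_suml mxE; apply: eq_bigr => i _.
  by rewrite !mxE phiZl.
rewrite qform1E (eq_bigr (fun i => `|emb (a i)| ^+ 2)) => [|i _]; last by rewrite mxE.
set S := \sum_i _; set x := nm L ^+ 2.
have x0 : 0 <= x by rewrite exprn_even_ge0.
have [->|xn0] := eqVneq x 0.
  by rewrite mulr_ge0 ?lecR ?(ltW B0) // sumr_ge0 // => i _; rewrite exprn_ge0.
have xp : 0 < (x%:C)%C :> C by rewrite ltcR lt_neqAle eq_sym xn0.
have -> : ((B * x)%:C)%C = (B%:C)%C * (x%:C)%C :> C by rewrite rcM.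
exact: le_of_sqr_le_mul.
Qed.

Theorem gram_coloring n' N (f : 'I_N -> H) (x : H) (m B e : R) :
  let t := m / B / 2 in
  0 < m -> m <= B -> 0 < e -> 1 <= n'.+1%:R * t ^+ 2 ->
  (forall i, m <= nm (f i) ^+ 2) ->
  (forall y, \sum_i `|phi (f i) y| ^+ 2 <= ((B * nm y ^+ 2)%:C)%C) ->
  \sum_i `|phi (f i) x| ^+ 2 <= (e%:C)%C ->
  exists c : 'I_N -> 'I_n'.+1, forall l (a : 'I_N -> K),
    (forall i, c i != l -> a i = 0) ->
    `|phi (\sum_i a i *: f i) x| ^+ 2 <=
      ((2 * n'.+1%:R * e / B * nm (\sum_i a i *: f i) ^+ 2)%:C)%C.
Proof.
move=> t m0 mB e0 nt fm Hb He; have B0 : 0 < B := lt_le_trans m0 mB.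
pose P := ((B^-1)%:C)%C *: gram f.
have Binv : 0 < (B^-1)%:C%C :> C by rewrite ltcR invr_gt0.
have Bi : exists a, emb a = ((B^-1)%:C)%C.
  have [surj|[surj _]] := emb_cases; first exact: surj.
  by apply: surj; rewrite gtr0_real.
have qP a : qform P (\row_i emb (a i)) (\row_i emb (a i)) =
    ((B^-1 * nm (\sum_i a i *: f i) ^+ 2)%:C)%C.
  by rewrite qformZm qform_gram -rmorphM.
have P_herm : adjmx P = P.
  by rewrite adjmxZ gram_herm (CrealP (gtr0_real Binv)).
have P_emb i j : exists a, P i j = emb a.
  by have [d dE] := Bi; exists (d * ip (f i) (f j)); rewrite !mxE rmorphM dE.
have P_pos : posdef P.
  apply: posdef_emb => // a; rewrite qP lecR mulr_ge0 ?invr_ge0 ?(ltW B0) //.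
  by rewrite exprn_even_ge0.
have Q_pos : posdef (1%:M - P).
  apply: posdef_emb => [|i j|a].
  - by rewrite adjmxD adjmxN adjmx1 P_herm.
  - have [d dE] := P_emb i j; exists ((i == j)%:R - d).
    by rewrite rmorphB rmorph_nat -dE !mxE.
  rewrite qformDm qformNm qP subr_ge0 qform1E.
  rewrite (eq_bigr (fun i => `|emb (a i)| ^+ 2)) => [|i _]; last by rewrite mxE.
  have Bp : 0 < (B%:C)%C :> C by rewrite ltcR.
  have := gram_bessel a B0 Hb; set X := nm _ ^+ 2; rewrite mulrC => HB.
  have -> : ((B^-1 * X)%:C)%C = (X%:C)%C / (B%:C)%C :> C.
    by rewrite rcM rcV mulrC.
  by rewrite ler_pdivrMr.
pose b : 'cV[C]_N := \col_i phi (f i) x.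
(* The diagonal of P is at least m / B, and (1 - g) / 2 is the t of the statement. *)
pose g : C := ((1 - m / B)%:C)%C.
have [| | | | | |c Hc] := @finite_coloring C n' N P b g ((e%:C)%C) P_pos Q_pos.
- by rewrite lecR subr_ge0 ler_pdivrMr ?mul1r.
- by rewrite (_ : 1 = (1%:C)%C) // ltcR gtrBl divr_gt0.
- move=> i; rewrite !mxE ip_nm -rmorphM /= (_ : 1 = (1%:C)%C) // -rmorphB lecR.
  by rewrite lerD2l lerN2 mulrC ler_wpM2l ?invr_ge0 ?(ltW B0).
- by rewrite ltcR.
- by rewrite (eq_bigr (fun i => `|phi (f i) x| ^+ 2)) => [|i _]; rewrite ?mxE.
- have -> : (1 - g) / 2 = (t%:C)%C.
    rewrite /g /t [in RHS]rcM rcV (rcn 2) rcB rc1; congr (_ / _).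
    by rewrite opprB addrC subrK.
  by rewrite expr2 -rcM -(rcn n'.+1) -rcM -rc1 lecR -expr2.
exists c => l a al; have := Hc l (\row_i emb (a i)).
have -> : (\row_i emb (a i) *m b) 0 0 = phi (\sum_i a i *: f i) x.
  by rewrite phi_suml mxE; apply: eq_bigr => i _; rewrite !mxE phiZl.
rewrite qP => /(_ _) /le_trans; apply.
  by move=> i /al; rewrite mxE => ->; rewrite rmorph0.
by rewrite -(rcn 2) -(rcn n'.+1) -!rcM lecR mulrA.
Qed.
End GramMatrices.

(** * Bessel families *)

Import numFieldNormedType.Exports.
Local Open Scope classical_set_scope.
Local Open Scope ring_scope.

(** The colour of i is the limit of the colours C s i along an ultrafilter of finite lists that
    contains all cones {s' | s <= s'}. On a given s the limit agrees with C s' for some s'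
    containing s. *)
Lemma finite_coloring_compactness (I : choiceType) (n : nat)
    (Q : seq I -> (I -> 'I_n) -> Prop) :
  (forall s c c', {in s, c =1 c'} -> Q s c -> Q s c') ->
  (forall s s' c, {subset s <= s'} -> Q s' c -> Q s c) ->
  (forall s, exists c, Q s c) -> exists c, forall s, Q s c.
Proof.
move=> Qeq Qsub /choice[C QC].
pose F := filter_from [set: seq I] (fun s => [set s' : seq I | {subset s <= s'}]).
have FP : ProperFilter F.
  apply: filter_from_proper; last by move=> s _; exists s.
  apply: filter_from_filter; first by exists [::].
  move=> s s' _ _; exists (s ++ s') => // w /= sw; split=> /= i si; apply: sw;
    by rewrite mem_cat si ?orbT.
have [U [UU FU]] := ultraFilterLemma FP.
have UP : ProperFilter U := @ultra_proper _ _ UU.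
have /choice[c cU] i : exists l, U [set s | C s i = l].
  apply: contrapT => /forallNP H.
  have : U [set s | forall l, C s i != l].
    apply: filter_forall => l.
    have [/H//|] := in_ultra_setVsetC [set s | C s i = l] UU.
    by apply: filterS => s /= /eqP.
  by move=> /filter_ex[s /(_ (C s i))]; rewrite eqxx.
exists c => s.
have /filter_ex[s' /= [ss' Cc]] :
    U [set s' : seq I | {subset s <= s'} /\ {in s, C s' =1 c}].
  apply: filterI; first by apply: FU; exists s.
  elim: s => [|i s IH]; first by apply: filterS filterT => s' _ i.
  apply: filterS2 (cU i) IH => s' /= Ci Cs j; rewrite inE => /orP[/eqP->//|].
  exact: Cs.
by apply: Qeq Cc _; apply: Qsub ss' (QC s').
Qed.

(** Take s0 with sum within e of the supremum of all finite sums; appending a disjoint list cannot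
    exceed that supremum. *)
Lemma small_tail_sums (R : realType) (I : choiceType) (a : I -> R) (B e : R) :
  (forall i, 0 <= a i) -> (forall s, uniq s -> \sum_(i <- s) a i <= B) -> 0 < e ->
  exists s0 : seq I, forall s, uniq s -> {in s, forall i, i \notin s0} ->
    \sum_(i <- s) a i <= e.
Proof.
move=> a0 aB e0; pose E := [set x | exists2 s, uniq s & x = \sum_(i <- s) a i].
have Eub : ubound E B by move=> _ [s us ->]; apply: aB.
have Esup : has_sup E by split; [exists 0, [::]; rewrite ?big_nil | exists B].
have [_ [s0 us0 ->] s0e] := sup_adherent e0 Esup.
exists s0 => s us ss0.
have : \sum_(i <- s0 ++ s) a i <= sup E.
  apply: ub_le_sup; first by exists B.
  exists (s0 ++ s) => //; rewrite cat_uniq us0 us andbT /=.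
  by apply/hasPn => i /ss0.
by rewrite big_cat /=; move: s0e; lra.
Qed.

Lemma scalar_embedding (R : realType) (k : scalar_kind) :
  exists emb : {rmorphism scalars R k -> R[i]%C},
  [/\ (forall z, exists a, emb a = z) \/
      ((forall z, z \is Num.real -> exists a, emb a = z) /\
       (forall a, emb a \is Num.real)),
      forall a, emb (scalar_conj a) = (emb a)^*,
      forall a, 0 <= a -> emb a = ((scalar_re a)%:C)%C &
      forall a, `|emb a| = ((scalar_re `|a|)%:C)%C].
Proof.
case: k => /=.
  exists (real_complex R); split=> //=.
  - right; split=> [z /complex_realP[x ->]|a]; first by exists x.
    by apply/complex_realP; exists a.
  - by move=> a; apply/esym/CrealP/complex_realP; exists a.
  - by move=> a; rewrite normc_def /= expr0n addr0 sqrtr_sqr.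
have re0 (a : R[i]%C) : 0 <= a -> a = ((complex.Re a)%:C)%C.
  by move=> /ger0_real/complex_realP[x ->].
exists idfun; split=> //=.
by left => z; exists z.
Qed.

Lemma polarization_gap (R : realFieldType) (a b c r : R) :
  0 <= a -> 0 <= b -> 0 <= c -> 2 * a < b -> r ^+ 2 <= b ^+ 2 / 4 * c ^+ 2 ->
  a ^+ 2 = b ^+ 2 + c ^+ 2 - 2 * r -> False.
Proof.
move=> a0 b0 c0 h1 h2 h3.
have rbc : r <= b * c / 2.
  have [r0|/ltW r0] := lerP r 0; first by apply: le_trans r0 _; rewrite divr_ge0 ?mulr_ge0.
  rewrite -(@ler_pXn2r _ 2) ?nnegrE ?divr_ge0 ?mulr_ge0 //.
  by apply: le_trans h2 _; rewrite le_eqVlt; apply/orP; left; apply/eqP; field.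
have h4 : (2 * a) ^+ 2 < b ^+ 2 by rewrite ltr_pXn2r ?nnegrE ?mulr_ge0.
have h5 := sqr_ge0 (c - b / 2); have h6 := sqr_ge0 b.
by rewrite sqrrB exprMn in h4 h5; nra.
Qed.

Section BesselFamilies.
Variables (R : realType) (k : scalar_kind).
Local Notation K := (scalars R k).
Variables (H : completeNormedModType K) (ip : {dot H for @scalar_conj R k}).
Hypothesis hip : induces_norm ip.
Variable emb : {rmorphism K -> R[i]%C}.
Hypothesis emb_cases :
  (forall z : R[i]%C, exists a, emb a = z) \/
  ((forall z : R[i]%C, z \is Num.real -> exists a, emb a = z) /\
   (forall a, emb a \is Num.real)).
Hypothesis emb_conj : forall a, emb (scalar_conj a) = (emb a)^*.
Hypothesis emb_pos : forall a, 0 <= a -> emb a = ((scalar_re a)%:C)%C.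
Hypothesis emb_norm : forall a, `|emb a| = ((scalar_re `|a|)%:C)%C.

Local Notation phi x y := (emb (ip x y)).

Let ipD x y z : ip (x + y) z = ip x z + ip y z.
Proof. exact: linearDl. Qed.

Let ipZ a x y : ip (a *: x) y = a * ip x y.
Proof. exact: linearZl_LR. Qed.

Let ip_sym x y : phi y x = (phi x y)^*.
Proof.
by rewrite -emb_conj [in LHS]hermitian_subproof expr0 mul1r.
Qed.

Let ip_nm x : phi x x = ((rnorm x ^+ 2)%:C)%C.
Proof. by rewrite hip rmorphXn /= emb_pos // rmorphXn. Qed.

Lemma rnorm_ge0 (V : normedZmodType K) (x : V) : 0 <= rnorm x.
Proof.
by have : 0 <= `|emb `|x| | by []; rewrite emb_norm normr_id lecR.
Qed.

Lemma emb_rnorm (V : normedZmodType K) (x : V) : emb `|x| = ((rnorm x)%:C)%C.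
Proof. exact: emb_pos. Qed.

Lemma rnorm0 : rnorm (0 : H) = 0.
Proof.
by apply: (fmorph_inj (real_complex R)); rewrite /= -emb_rnorm normr0 !rmorph0.
Qed.

Lemma emb_lt (a b : K) : a < b -> emb a < emb b.
Proof.
move=> ab; rewrite -subr_gt0 -rmorphB lt_neqAle eq_sym fmorph_eq0 subr_eq0 gt_eqF //=.
have c0 : 0 <= b - a by rewrite subr_ge0 ltW.
by rewrite emb_pos // -[b - a]ger0_norm // -emb_norm.
Qed.

Lemma norm_phi x y : `|phi x y| ^+ 2 = ((rnorm (ip x y) ^+ 2)%:C)%C.
Proof. by rewrite emb_norm rmorphXn. Qed.

Lemma linear_span_mono (V : lmodType K) (A B : set V) : A `<=` B ->
  linear_span A `<=` linear_span B.
Proof.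
by move=> AB x [n [c [v [Av ->]]]]; exists n, c, v; split=> // i; apply: AB.
Qed.

(* |z - v|^2 >= |z|^2 + |v|^2 - |z||v| >= 3/4 |z|^2 keeps z away from the span. *)
Lemma not_spans (I : Type) (f : I -> H) (S : set I) (z : H) : z != 0 ->
  (forall v, linear_span (f @` S) v ->
     `|phi v z| ^+ 2 <= ((rnorm z ^+ 2 / 4 * rnorm v ^+ 2)%:C)%C) ->
  ~ spans f S.
Proof.
move=> z0 Hz; rewrite /spans => clE.
have : closure (linear_span (f @` S)) z by rewrite clE.
have nz : 0 < `|z| by rewrite normr_gt0.
move=> /(_ _ (nbhsx_ballx z (`|z| / 2) _))[|v [/Hz Hv]]; first by rewrite divr_gt0.
rewrite -ball_normE /ball_ /= => vz.
have {}vz : 2 * rnorm (z - v) < rnorm z.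
  move: (emb_lt vz); rewrite rmorphM fmorphV rmorph_nat /= !emb_rnorm.
  rewrite ltr_pdivlMr ?ltr0Sn // -(rmorph_nat (real_complex R)).
  by rewrite -(rmorphM (real_complex R)) ltcR mulrC.
have phiB x y w : phi (x - y) w = phi x w - phi y w.
  by rewrite -scaleN1r ipD ipZ mulN1r rmorphB.
have [r rE] : exists r, 'Re (phi v z) = (r%:C)%C.
  by apply/complex_realP/Creal_Re.
have r2 : r ^+ 2 <= rnorm z ^+ 2 / 4 * rnorm v ^+ 2.
  rewrite -lecR; apply: le_trans Hv; rewrite normC2_Re_Im rE.
  by rewrite rmorphXn lerDl -real_normK ?Creal_Im ?exprn_ge0.
have nE : rnorm (z - v) ^+ 2 = rnorm z ^+ 2 + rnorm v ^+ 2 - 2 * r.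
  apply: (fmorph_inj (real_complex R)) => /=.
  have : phi (z - v) (z - v) = phi z z + phi v v - (phi v z + (phi v z)^* ).
    rewrite phiB [phi z (_ - _)]ip_sym [phi v (_ - _)]ip_sym !phiB.
    by rewrite !rmorphB /= -!ip_sym; ring.
  have -> : phi v z + (phi v z)^* = ((2 * r)%:C)%C.
    have -> : phi v z + (phi v z)^* = 2 * 'Re (phi v z).
      by rewrite ReE mulrC divfK ?pnatr_eq0.
    by rewrite rE -(rmorph_nat (real_complex R)) -(rmorphM (real_complex R)).
  rewrite !ip_nm => ->.
  by rewrite (rmorphB (real_complex R)) (rmorphD (real_complex R)).
exact: (polarization_gap (rnorm_ge0 _) (rnorm_ge0 _) (rnorm_ge0 v) vz r2 nE).
Qed.

Lemma linear_span_image (I : Type) (f : I -> H) (S : set I) v :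
  linear_span (f @` S) v -> exists n (a : 'I_n -> K) (j : 'I_n -> I),
    (forall q, S (j q)) /\ v = \sum_(q < n) a q *: f (j q).
Proof.
move=> [n [a [w [Sw ->]]]].
have /fin_all_exists[j Hj] q : exists i, S i /\ f i = w q.
  by have [i Si <-] := Sw q; exists i.
exists n, a, j; split=> [q|]; first by have [] := Hj q.
by apply: eq_bigr => q _; have [_ ->] := Hj q.
Qed.

Lemma finite_family_coloring (I : choiceType) (f : I -> H) (x : H) (m B e : R)
    (n' : nat) (s0 s : seq I) :
  let t := m / B / 2 in
  0 < m -> m <= B -> 0 < e -> 1 <= n'.+1%:R * t ^+ 2 ->
  (forall i, m <= rnorm (f i) ^+ 2) ->
  (forall r y, uniq r -> \sum_(i <- r) rnorm (ip y (f i)) ^+ 2 <= B * rnorm y ^+ 2) ->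
  (forall r, uniq r -> {in r, forall i, i \notin s0} ->
     \sum_(i <- r) rnorm (ip x (f i)) ^+ 2 <= e) ->
  exists c : I -> 'I_n'.+1, forall l v,
    linear_span (f @` [set i | [/\ i \in s, i \notin s0 & c i = l]]) v ->
    `|phi v x| ^+ 2 <= ((2 * n'.+1%:R * e / B * rnorm v ^+ 2)%:C)%C.
Proof.
move=> t m0 mB e0 nt fm Hb He.
pose r := [seq i <- undup s | i \notin s0].
have ur : uniq r by rewrite filter_uniq // undup_uniq.
pose T := in_tuple r; pose g p := f (tnth T p).
have sumE (y : H) : \sum_p `|phi (g p) y| ^+ 2 =
    ((\sum_(i <- r) rnorm (ip y (f i)) ^+ 2)%:C)%C.
  rewrite (big_tnth _ _ r) rmorph_sum; apply: eq_bigr => p _.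
  by rewrite ip_sym norm_conjC norm_phi.
have [|y||c Hc] := @gram_coloring R K emb H ip (@rnorm R k H) emb_cases ipD ipZ
    ip_sym ip_nm n' _ g x m B e m0 mB e0 nt.
- by move=> p; apply: fm.
- by rewrite sumE lecR Hb.
- by rewrite sumE lecR He // => i; rewrite mem_filter => /andP[].
pose d i := if [pick p | tnth T p == i] is Some p then c p else ord0.
have dE p : d (tnth T p) = c p.
  rewrite /d; case: pickP => [q /eqP qp|/(_ p)]; last by rewrite eqxx.
  by congr c; apply: (tuple_uniqP T ur).
exists d => l v /linear_span_image[M [a [j [Hj ->]]]].
have /fin_all_exists[p Hp] (q : 'I_M) : exists i, tnth T i = j q.
  have [js js0 _] := Hj q.
  have /tnthP[p ->] : j q \in T by rewrite mem_filter js0 mem_undup.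
  by exists p.
(* A linear combination in the span may repeat an index; its coefficients are collected. *)
pose b i := \sum_(q | p q == i) a q.
have -> : \sum_q a q *: f (j q) = \sum_i b i *: g i.
  rewrite (partition_big p xpredT) //=; apply: eq_bigr => i _.
  rewrite /b scaler_suml; apply: eq_bigr => q /eqP <-.
  by rewrite /g Hp.
apply: Hc => i ci; rewrite /b big_pred0 // => q; apply/negbTE.
apply: contraNneq ci => <-; rewrite -dE Hp.
by have [_ _ ->] := Hj q.
Qed.

Theorem bessel_nonspanning_partition (I : choiceType) (f : I -> H) :
  ~ one_dimensional H -> bessel ip f -> bounded_family f ->
  exists (n : nat) (S : 'I_n -> set I),
    \bigcup_(j in [set: 'I_n]) S j = [set: I] /\
    forall j : 'I_n, ~ spans f (S j).
Proof.
move=> hdim [B0 hB] [inf_gt0 inf_le_sup _].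
(* Over an empty index set the infimum is +oo and the supremum -oo, against [inf_le_sup]. *)
have [i0 _] : exists i0 : I, True.
  apply: contrapT => /forallNP I0; move: inf_le_sup.
  have -> : [set (rnorm (f i))%:E | i in [set: I]] = set0.
    by apply/seteqP; split=> // y [j]; have := I0 j.
  by rewrite ereal_inf0 ereal_sup0.
have [m1 m10 fm1] : exists2 m1, 0 < m1 & forall i, m1 <= rnorm (f i).
  have lb i : (ereal_inf [set (rnorm (f i))%:E | i in [set: I]] <= (rnorm (f i))%:E)%E.
    by apply: ereal_inf_lbound; exists i.
  move: inf_gt0 lb; move: (ereal_inf _) => [r|_ /(_ i0)|] //.
  by rewrite lte_fin => r0 lb; exists r => // i; rewrite -lee_fin.
have sumB r y : uniq r -> \sum_(i <- r) rnorm (ip y (f i)) ^+ 2 <= B0 * rnorm y ^+ 2.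
  move=> ur; rewrite -lee_fin; apply: le_trans (hB y).
  apply: ereal_sup_ubound; exists [set` r]; first by split=> //; apply: finite_seq.
  by rewrite -fsbig_seq // sumEFin.
pose m := m1 ^+ 2; have m0 : 0 < m by rewrite exprn_gt0.
have fm i : m <= rnorm (f i) ^+ 2.
  by rewrite /m ler_pXn2r ?nnegrE ?rnorm_ge0 // ltW.
pose B := `|B0| + m; have mB : m <= B by rewrite lerDr.
have Bp : 0 < B := lt_le_trans m0 mB.
have {}sumB r y : uniq r -> \sum_(i <- r) rnorm (ip y (f i)) ^+ 2 <= B * rnorm y ^+ 2.
  move=> /(sumB _ y)/le_trans; apply; rewrite ler_wpM2r ?exprn_even_ge0 //.
  by rewrite /B (le_trans (ler_norm _)) // lerDl ltW.
pose x := f i0; have x0 : 0 < rnorm x := lt_le_trans m10 (fm1 i0).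
have xn0 y : 0 < rnorm y -> y != 0 :> H.
  by apply: contraTneq => ->; rewrite rnorm0 ltxx.
pose t := m / B / 2; have t0 : 0 < t by rewrite !divr_gt0.
have [n' nt] : exists n', 1 <= n'.+1%:R * t ^+ 2.
  exists (Num.bound (t ^+ 2)^-1); rewrite -ler_pdivrMr ?exprn_gt0 // mul1r.
  have /archi_boundP/ltW/le_trans : 0 <= (t ^+ 2)^-1 by rewrite invr_ge0 exprn_ge0 // ltW.
  by apply; rewrite ler_nat.
(* The constant 2 n e / B of the colouring becomes |x|^2 / 4, as [not_spans] requires. *)
pose n := n'.+1; pose e := rnorm x ^+ 2 * B / (8 * n%:R).
have e0 : 0 < e by rewrite divr_gt0 ?mulr_gt0 ?exprn_gt0 ?ltr0Sn.
have eE : 2 * n%:R * e / B = rnorm x ^+ 2 / 4.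
  by rewrite /e; field; rewrite pnatr_eq0 gt_eqF.
have [s0 Hs0] : exists s0 : seq I, forall r, uniq r ->
    {in r, forall i, i \notin s0} -> \sum_(i <- r) rnorm (ip x (f i)) ^+ 2 <= e.
  apply: (@small_tail_sums _ _ _ (B * rnorm x ^+ 2)) => // [i|r ur].
    by rewrite exprn_even_ge0.
  exact: sumB.
have [||s|c Hc] := @finite_coloring_compactness I n (fun s c => forall l v,
    linear_span (f @` [set i | [/\ i \in s, i \notin s0 & c i = l]]) v ->
    `|phi v x| ^+ 2 <= ((rnorm x ^+ 2 / 4 * rnorm v ^+ 2)%:C)%C).
- move=> s c c' cc' Hc l v vS; apply: (Hc l); apply: linear_span_mono vS.
  by apply: image_subset => i [si is0 <-]; split=> //; rewrite cc'.
- move=> s s' c ss' Hc l v vS; apply: (Hc l); apply: linear_span_mono vS.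
  by apply: image_subset => i [/ss' si is0 ci]; split.
- have [c Hc] := finite_family_coloring s m0 mB e0 nt fm sumB Hs0.
  by exists c; rewrite -eE.
pose S (j : 'I_(n + size s0)) := match fintype.split j with
  | inl l => [set i | i \notin s0 /\ c i = l]
  | inr q => [set tnth (in_tuple s0) q] end.
exists (n + size s0)%N, S; split.
  apply/seteqP; split=> // i _; have [/tnthP[q qi]|is0] := boolP (i \in in_tuple s0).
    by exists (rshift n q); rewrite // /S (unsplitK (inr q)).
  by exists (lshift (size s0) (c i)); rewrite // /S (unsplitK (inl (c i))).
move=> j; rewrite /S; case: fintype.split => [l|q].
  apply: (@not_spans _ _ _ x); first exact: xn0.
  move=> v /linear_span_image[M [a [w [Hw vE]]]].
  (* A vector of the span involves finitely many indices; [codom w] lists them. *)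
  apply: (Hc (codom w) l); exists M, a, (fun q => f (w q)); split=> // q.
  have [ws0 cw] := Hw q; exists (w q) => //; split=> //.
  exact: codom_f.
set i := tnth _ _; have fi0 : f i != 0 by apply/xn0/(lt_le_trans m10).
have [y yf] : exists y, forall a, y <> a *: f i.
  apply: contrapT => H1; apply: hdim; exists (f i) => // y.
  by apply: contrapT => H2; apply: H1; exists y => a ya; apply: H2; exists a.
have ff0 : ip (f i) (f i) != 0 by rewrite hip expf_neq0 // normr_eq0.
(* For a singleton class the witness is the component of y orthogonal to [f i], nonzero because y is
   no multiple of [f i]. *)
pose z := y - (ip y (f i) / ip (f i) (f i)) *: f i.
have zi : ip z (f i) = 0.
  rewrite /z -scaleN1r scalerA ipD ipZ mulN1r mulNr divfK //.
  by rewrite subrr.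
apply: (@not_spans _ _ _ z); first by apply/eqP => /subr0_eq/yf.
move=> v /linear_span_image[M [a [w [Hw ->]]]].
have -> : phi (\sum_q a q *: f (w q)) z = 0.
  rewrite (phi_suml emb ipD ipZ) big1 // => p _.
  by rewrite (Hw p) ipZ rmorphM /= ip_sym zi !rmorph0 mulr0.
by rewrite normr0 expr0n lecR mulr_ge0 ?divr_ge0 ?exprn_even_ge0.
Qed.

End BesselFamilies.

(* In a line every nonzero vector spans, so the claim fails there for any
   nonempty family; this is the only dimension that has to be excluded. *)
Theorem mainTheorem5 (R : realType) (k : scalar_kind)
    (H : completeNormedModType (scalars R k))
    (ip : {dot H for @scalar_conj R k}) (hip : induces_norm ip)
    (hdim : ~ one_dimensional H)
    (I : choiceType) (f : I -> H)
    (hbessel : bessel ip f) (hbounded : bounded_family f) :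
  exists (n : nat) (S : 'I_n -> set I),
    \bigcup_(j in [set: 'I_n]) S j = [set: I] /\
    forall j : 'I_n, ~ spans f (S j).
Proof.
have [emb [Ecases Econj Epos Enorm]] := scalar_embedding R k.
exact: (bessel_nonspanning_partition hip Ecases Econj Epos Enorm hdim hbessel).
Qed.
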